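(* Let $m>1$, $D>0$, $r>0$, let $b,d$ satisfy the standing assumptions below, and assume $b'(\kappa)<0$. Then there exists a number $c_\kappa=c_\kappa(m,r,b'(\kappa),d'(\kappa))\in(0,+\infty]$ such that no semi-wavefront of the wave profile equation $$c\phi'(t)=D(\phi^m)''(t)-d(\phi(t))+b(\phi(t-cr)),\qquad t\in\mathbb R,$$ with speed $c>c_\kappa$ is eventually monotone (i.e., such semi-wavefronts must oscillate around $\kappa$, whether convergent or not). Moreover, $$c_\kappa(m,r,b'(\kappa),d'(\kappa))=\frac{\mu_\kappa(m,b'(\kappa),d'(\kappa))+o(1)}{r},\qquad r\to+\infty,$$ where $\mu_\kappa(m,b'(\kappa),d'(\kappa)):=\sqrt{\frac{2Dm\kappa^{m-1}\omega_\kappa}{b'(\kappa)}}\,e^{\frac{\omega_\kappa}{2}}$ and $\omega_\kappa<-2$ is the unique negative root of $2d'(\kappa)=b'(\kappa)e^{-\omega_\kappa}(2+\omega_\kappa)$.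
   Context: Standing assumptions: the death rate $d\in C^2([0,+\infty))$ satisfies $d(0)=0$, $d'(s)>0$ and $d''(s)\ge0$ for $s>0$. The birth rate $b\in C^1([0,+\infty);[0,+\infty))$ has exactly one positive local extremum point $s_M$, which is its global maximum point; $b(0)=0$; there is $\kappa>0$ with $b(\kappa)=d(\kappa)$; $b'(0)>d'(0)$; $b'(\kappa)<d'(\kappa)$; and $d(s)<b(s)\le b'(0)s$ for $s\in(0,\kappa)$. Moreover $s_M<\kappa$. Definition: a function $0\le\phi\in W^{1,1}_{\rm loc}(\mathbb R)\cap L^\infty(\mathbb R)$ with $\phi^m\in W^{1,1}_{\rm loc}(\mathbb R)$ is a semi-wavefront (of speed $c>0$) if (i) it satisfies the wave profile equation in the sense of distributions; (ii) $\phi(-\infty)=0$ and $0<\liminf_{t\to+\infty}\phi\le\limsup_{t\to+\infty}\phi<+\infty$; (iii) there is a maximal interval $(-\infty,t_0)$, $t_0\in(-\infty,+\infty]$, on which $\phi$ is monotonically increasing, and if $t_0<+\infty$ then $\phi(t_0)>\kappa$. Eventually monotone means monotone on some interval $[T,+\infty)$. *)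

(* Defs.v *)
From HB Require Import structures.
From mathcomp Require Import all_boot all_order all_algebra.
From mathcomp Require Import all_classical all_reals all_analysis.
Set Implicit Arguments. Unset Strict Implicit. Unset Printing Implicit Defensive.
Import Order.TTheory GRing.Theory Num.Theory.
Import numFieldNormedType.Exports.
Local Open Scope classical_set_scope.
Local Open Scope ring_scope.

Section Defs.
Variable R : realType.
Local Notation mu := (@lebesgue_measure R).

Definition test_fun (f : R -> R) : Prop :=
  (forall (n : nat) (x : R), derivable (derive1n n f) x 1) /\
  exists M : R, forall x, M < `|x| -> f x = 0.

Definition loc_int (f : R -> R) : Prop :=
  forall a b : R, mu.-integrable `[a, b] (EFin \o f).

Definition weak_deriv (f g : R -> R) : Prop :=
  loc_int g /\
  forall chi, test_fun chi ->
    Rintegral mu setT (fun x => f x * derive1 chi x)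
    = - Rintegral mu setT (fun x => g x * chi x).

Definition W11loc (f : R -> R) : Prop := loc_int f /\ exists g, weak_deriv f g.

(** f is C^1 on [0,+oo) with derivative f' (f' 0 is then the right derivative) *)
Definition C1_nonneg (f f' : R -> R) : Prop :=
  {within [set x : R | 0 <= x], continuous f} /\
  {within [set x : R | 0 <= x], continuous f'} /\
  (forall x : R, 0 < x -> is_derive x 1 f (f' x)).

Definition loc_extremum (f : R -> R) (s : R) : Prop :=
  (\forall y \near s, f y <= f s) \/ (\forall y \near s, f s <= f y).

Definition standing (b b1 d d1 d2 : R -> R) (kappa : R) : Prop :=
  [/\ C1_nonneg d d1, C1_nonneg d1 d2, d 0 = 0,
      (forall s, 0 < s -> 0 < d1 s) & (forall s, 0 < s -> 0 <= d2 s)] /\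
  [/\ C1_nonneg b b1, (forall s, 0 <= s -> 0 <= b s),
      (exists sM, [/\ 0 < sM, sM < kappa,
                      forall s, 0 <= s -> b s <= b sM &
                      forall s, 0 < s -> loc_extremum b s -> s = sM]),
      b 0 = 0 &
      [/\ 0 < kappa, b kappa = d kappa, b1 0 > d1 0, b1 kappa < d1 kappa &
          forall s, 0 < s < kappa -> d s < b s /\ b s <= b1 0 * s]].

Definition nondecr_below (phi : R -> R) (t0 : \bar R) : Prop :=
  forall s t : R, (s%:E < t0)%E -> (t%:E < t0)%E -> s <= t -> phi s <= phi t.

Definition wave_eq_distr (m D r c : R) (b d : R -> R) (phi : R -> R) : Prop :=
  forall chi, test_fun chi ->
    - c * Rintegral mu setT (fun t => phi t * derive1 chi t)
    = D * Rintegral mu setT (fun t => phi t `^ m * derive1n 2 chi t)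
      - Rintegral mu setT (fun t => d (phi t) * chi t)
      + Rintegral mu setT (fun t => b (phi (t - c * r)) * chi t).

(** semi-wavefront of speed c (phi is the continuous representative) *)
Definition semi_wavefront (m D r c : R) (b d : R -> R) (kappa : R)
    (phi : R -> R) : Prop :=
  [/\ 0 < c, continuous phi, (forall t, 0 <= phi t),
      [/\ W11loc phi, W11loc (fun t => phi t `^ m),
          (exists M, forall t, `|phi t| <= M)                (* L^infty *) &
          wave_eq_distr m D r c b d phi] &
   [/\
       phi t @[t --> -oo] --> 0,
       (exists a, 0 < a /\ \forall t \near +oo, a <= phi t)  (* liminf > 0 *),
       (exists M, \forall t \near +oo, phi t <= M)        (* limsup < +oo *) &
       (exists t0 : \bar R,
         [/\ nondecr_below phi t0,
             (forall t1 : \bar R, (t0 < t1)%E -> ~ nondecr_below phi t1) &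
             forall x : R, t0 = x%:E -> phi x > kappa])]].

Definition eventually_monotone (phi : R -> R) : Prop :=
  exists T : R,
    (forall s t, T <= s -> s <= t -> phi s <= phi t) \/
    (forall s t, T <= s -> s <= t -> phi t <= phi s).

Definition mu_kappa (m D kappa bk omega : R) : R :=
  Num.sqrt (2 * D * m * kappa `^ (m - 1) * omega / bk) * expR (omega / 2).

End Defs.

(* Main.v *)
(** A bounded, eventually monotone profile converges, and the equation forces
    its limit to be an equilibrium, hence [kappa].  It is not eventually equal
    to [kappa], since constancy would propagate to the left through the delay.
    By a du Bois-Reymond argument [w = phi^m] is a classical solution of
    [D w'' = c phi' + d(phi) - b(phi(. - cr))], so [v = |kappa^m - w|] is
    positive, nonincreasing and satisfies, up to arbitrarily small errors in the
    coefficients, the linearised inequality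
    [D v'' >= c0 v' + q0 v + p0 v(. - h)], [h = c r].  If [v' + l v <= 0]
    eventually, then [v(. - h) >= e^(l h) v], and [l] may be replaced by the
    positive root [l'] of [D l'^2 + c0 l' = q0 + p0 e^(l h)].  As [v(. - h/4)]
    is bounded by a multiple of [v], such rates are bounded, and their supremum
    satisfies [q0 + p0 e^(l h) <= D l^2 + c0 l].  In terms of [x = l c r] this is
    [q + p e^x <= A x^2/(c r)^2 + x/r], with [A = D m kappa^(m-1)],
    [q = d'(kappa)], [p = -b'(kappa)].  Without the term [x/r] it holds for some
    [x >= 0] iff [c r <= mu_kappa], the two sides being tangent at
    [x = -omega_kappa] when [c r = mu_kappa]; the term [x/r <= e^x/r] only
    changes [mu_kappa] by a factor [(1 - 1/(p r))^(-1/2)]. *)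
Require Import Defs.
From HB Require Import structures.
From mathcomp Require Import all_boot all_order all_algebra.
From mathcomp Require Import all_classical all_reals all_analysis.
From mathcomp Require Import ring lra.
Set Implicit Arguments. Unset Strict Implicit. Unset Printing Implicit Defensive.
Import Order.TTheory GRing.Theory Num.Theory.
Import numFieldNormedType.Exports.
Local Open Scope classical_set_scope.
Local Open Scope ring_scope.

(** * Pointwise derivatives on the real line and mean value bounds *)

Section PointwiseDerivatives.
Variable R : realType.
Implicit Types (f g : R -> R) (x : R).

Lemma is_derive_cstR (k : R) x : is_derive x 1 (fun=> k) 0.
Proof. exact: is_derive_cst. Qed.

Lemma is_derive_idR x : is_derive x 1 (fun y : R => y) 1.
Proof. exact: is_derive_id. Qed.

Lemma is_derive_addR f g x a b : is_derive x 1 f a -> is_derive x 1 g b ->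
  is_derive x 1 (fun y => f y + g y) (a + b).
Proof. by move=> hf hg; exact: is_deriveD. Qed.

Lemma is_derive_mulR f g x a b : is_derive x 1 f a -> is_derive x 1 g b ->
  is_derive x 1 (fun y => f y * g y) (f x * b + g x * a).
Proof. by move=> hf hg; exact: is_deriveM. Qed.

Lemma is_derive_scaleR k f x a : is_derive x 1 f a ->
  is_derive x 1 (fun y => k * f y) (k * a).
Proof. by move=> hf; have := @is_deriveZ _ _ _ f k x 1 a hf. Qed.

Lemma is_derive_compR f g x a b : is_derive (g x) 1 f a -> is_derive x 1 g b ->
  is_derive x 1 (fun y => f (g y)) (a * b).
Proof. by move=> hf hg; exact: (is_derive1_comp hf hg). Qed.

Lemma is_derive_expRM (k x : R) :
  is_derive x 1 (fun y => expR (k * y)) (k * expR (k * x)).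
Proof.
have := is_derive_compR (is_derive_expR (k * x)) (is_derive_scaleR k (is_derive_idR x)).
by rewrite mulr1 mulrC.
Qed.

Lemma is_derive_continuous f x a : is_derive x 1 f a -> {for x, continuous f}.
Proof.
by move=> [df _]; apply/differentiable_continuous/derivable1_diffP.
Qed.

Lemma is_derive_within_continuous f f' a b :
  (forall x, a <= x <= b -> is_derive x 1 f (f' x)) ->
  {within `[a, b], continuous f}.
Proof.
move=> df; apply: continuous_in_subspaceT => x /[!inE]/= /[!in_itv]/= /df.
exact: is_derive_continuous.
Qed.

Lemma derive_ge_sub f f' a b k : a <= b ->
  (forall x, a <= x <= b -> is_derive x 1 f (f' x)) ->
  (forall x, a <= x <= b -> k <= f' x) -> k * (b - a) <= f b - f a.
Proof.
move=> ab df kf.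
have [x xab|c cab ->] := MVT_segment ab (f := f) (df := f') _
  (is_derive_within_continuous df).
  by apply: df; move: xab; rewrite in_itv/= => /andP[/ltW -> /ltW ->].
by apply: ler_wpM2r; rewrite ?subr_ge0//; apply: kf; move: cab; rewrite in_itv.
Qed.

Lemma derive_ge0_le f f' a b : a <= b ->
  (forall x, a <= x <= b -> is_derive x 1 f (f' x)) ->
  (forall x, a <= x <= b -> 0 <= f' x) -> f a <= f b.
Proof.
by move=> ab df f0; have := derive_ge_sub ab df f0; rewrite mul0r subr_ge0.
Qed.

End PointwiseDerivatives.

(** * Smooth functions and construction of a smooth ramp *)

Section SmoothFunctions.
Variable R : realType.
Implicit Types (f g : R -> R) (n : nat) (x : R).

(** The recursion passes to [derive1 f], so closure properties follow by induction on [n] with [f]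
    generalised; [diff_upto_derive1n] returns to the form used in [test_fun]. *)
Fixpoint diff_upto n f : Prop :=
  if n is k.+1 then (forall x, derivable f x 1) /\ diff_upto k (derive1 f)
  else True.

Lemma diff_upto_derive1n f : (forall n, diff_upto n f) ->
  forall n x, derivable (derive1n n f) x 1.
Proof.
move=> sf n; elim: n f sf => [|n IH] f sf x; first by case: (sf 1%N).
by rewrite derive1Sn; apply: IH => k; case: (sf k.+1).
Qed.

Lemma is_derive_derive1 f f' : (forall x : R, is_derive x 1 f (f' x)) ->
  derive1 f = f'.
Proof. by move=> df; apply/funext => x; rewrite derive1E; case: (df x). Qed.

Lemma diff_uptoS n f f' : (forall x : R, is_derive x 1 f (f' x)) ->
  diff_upto n f' -> diff_upto n.+1 f.
Proof.
by move=> df sf'; split; [move=> x; case: (df x) | rewrite (is_derive_derive1 df)].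
Qed.

Lemma diff_uptoS_is_derive n f : diff_upto n.+1 f ->
  forall x : R, is_derive x 1 f (derive1 f x).
Proof. by move=> [df _] x; apply: DeriveDef => //; rewrite derive1E. Qed.

Lemma diff_uptoW n f : diff_upto n.+1 f -> diff_upto n f.
Proof. by elim: n f => // n IH f [df sf]; split => //; exact: IH. Qed.

Lemma diff_upto_cst n (k : R) : diff_upto n (fun=> k).
Proof.
elim: n k => // n IH k; apply: diff_uptoS (IH 0) => x; exact: is_derive_cstR.
Qed.

Lemma diff_upto_id n : diff_upto n (fun x : R => x).
Proof.
case: n => // n; apply: diff_uptoS (diff_upto_cst n 1) => x; exact: is_derive_idR.
Qed.

Lemma diff_upto_add n f g : diff_upto n f -> diff_upto n g ->
  diff_upto n (fun x => f x + g x).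
Proof.
elim: n f g => // n IH f g sf sg.
apply: (diff_uptoS (f' := fun x => derive1 f x + derive1 g x)).
  by move=> x; exact: is_derive_addR (diff_uptoS_is_derive sf x) (diff_uptoS_is_derive sg x).
by case: sf sg => [_ sf] [_ sg]; exact: IH.
Qed.

Lemma diff_upto_mul n f g : diff_upto n f -> diff_upto n g ->
  diff_upto n (fun x => f x * g x).
Proof.
elim: n f g => // n IH f g sf sg.
apply: (diff_uptoS (f' := fun x => f x * derive1 g x + g x * derive1 f x)).
  by move=> x; exact: is_derive_mulR (diff_uptoS_is_derive sf x) (diff_uptoS_is_derive sg x).
by apply: diff_upto_add; apply: IH; by [exact: diff_uptoW | case: sf | case: sg].
Qed.

Lemma diff_upto_scale n k f : diff_upto n f -> diff_upto n (fun x => k * f x).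
Proof. by move=> sf; apply: diff_upto_mul => //; exact: diff_upto_cst. Qed.

Lemma is_derive_affine f k a x l : is_derive (k * x + a) 1 f l ->
  is_derive x 1 (fun y => f (k * y + a)) (k * l).
Proof.
move=> df; have da : is_derive x 1 (fun y => k * y + a) (k * 1 + 0).
  exact: is_derive_addR (is_derive_scaleR k (is_derive_idR x)) (is_derive_cstR a x).
have := @is_derive_compR _ f (fun y => k * y + a) x _ _ df da.
by rewrite addr0 mulr1 mulrC.
Qed.

Lemma diff_upto_affine n f k a : diff_upto n f ->
  diff_upto n (fun x => f (k * x + a)).
Proof.
elim: n f => // n IH f sf.
apply: (diff_uptoS (f' := fun x => k * derive1 f (k * x + a))).
  by move=> x; exact: is_derive_affine (diff_uptoS_is_derive sf _).
by apply: diff_upto_scale; apply: IH; case: sf.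
Qed.

(** The derivative - f' (1/f)(1/f) involves 1/f again, but with one order of smoothness less to
    prove. *)
Lemma diff_upto_inv n f : (forall x, f x != 0) -> diff_upto n f ->
  diff_upto n (fun x => (f x)^-1).
Proof.
move=> f0; elim: n => // n IH sf.
have df (x : R) : is_derive x 1 (fun x => (f x)^-1)
    (- 1 * (derive1 f x * ((f x)^-1 * (f x)^-1))).
  apply: is_derive_eq (is_deriveV (f0 x) (diff_uptoS_is_derive sf x)) _.
  by rewrite -exprVn expr2 /GRing.scale/=; ring.
refine (diff_uptoS df _); apply: diff_upto_scale; apply: diff_upto_mul; first by case: sf.
by have := IH (diff_uptoW sf) => ?; exact: diff_upto_mul.
Qed.

(** The difference quotient at 0 is at most K |h|. This settles the one point where the functions
    [flat n] are glued. *)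
Lemma is_derive0_quadratic f (K : R) : f 0 = 0 ->
  (forall x, `|f x| <= K * x ^+ 2) -> is_derive (0 : R) 1 f 0.
Proof.
move=> f0 fK.
have K0 : 0 <= K by have := fK 1; rewrite expr1n mulr1; exact: le_trans (normr_ge0 _).
suff H : (fun h : R => h^-1 *: ((f \o shift 0) (h *: 1) - f 0)) @ 0^' --> (0 : R).
  apply: DeriveDef; first by apply/cvg_ex; exists 0.
  by apply/cvg_lim => //; exact: Rhausdorff.
apply/cvgrPdist_le => e e0; near=> h.
have h0 : h != 0 by near: h; exact: nbhs_dnbhs_neq.
rewrite sub0r normrN f0 subr0 /= addr0 /GRing.scale/= mulr1 normrM normfV.
rewrite ler_pdivrMl ?normr_gt0//; apply: le_trans (fK h) _.
rewrite -real_normK ?num_real// expr2 mulrCA ler_wpM2l//.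
have : `|h| <= e / (K + 1).
  near: h; apply: dnbhs0_le; rewrite divr_gt0// ltr_wpDl//.
rewrite ler_pdivlMr; last by rewrite ltr_wpDl.
by apply: le_trans; rewrite mulrC ler_wpM2l// lerDl.
Unshelve. all: by end_near. Qed.

(* [x^-n e^(-1/x)] extended by 0 to [x <= 0]: the span of this family is stable
   under differentiation. *)
Definition flat n (x : R) : R :=
  if 0 < x then x^-1 ^+ n * expR (- x^-1) else 0.

Lemma flat_gt0 (x : R) : 0 < x -> 0 < flat 0 x.
Proof. by move=> x0; rewrite /flat x0 expr0 mul1r expR_gt0. Qed.

Lemma flat_le0 n (x : R) : x <= 0 -> flat n x = 0.
Proof. by rewrite /flat leNgt => /negbTE ->. Qed.

Lemma flat_ge0 n (x : R) : 0 <= flat n x.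
Proof.
by rewrite /flat; case: ifPn => // x0; rewrite mulr_ge0 ?expR_ge0// exprn_ge0// invr_ge0 ltW.
Qed.

(** From z <= e^z at z = y / (n + 1), raised to the power n + 1. *)
Lemma expR_dominates_power n (y : R) : 0 <= y -> y ^+ n.+1 <= n.+1%:R ^+ n.+1 * expR y.
Proof.
move=> y0; have n0 : 0 < n.+1%:R :> R by rewrite ltr0n.
have -> : y = n.+1%:R * (y / n.+1%:R) by rewrite mulrC divfK// gt_eqF.
rewrite expRM_natl exprMn ler_pM2l ?exprn_gt0//.
apply: lerXn2r; rewrite ?nnegrE ?divr_ge0 ?(ltW n0) ?expR_ge0//.
by apply: le_trans (expR_ge1Dx _); rewrite lerDr.
Qed.

(** With y = 1/x, the bound y^(n+2) <= (n+2)^(n+2) e^y is divided by y^2 e^y. *)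
Lemma flat_quadratic n (x : R) : `|flat n x| <= n.+2%:R ^+ n.+2 * x ^+ 2.
Proof.
rewrite ger0_norm ?flat_ge0// /flat; case: ifPn => x0; last first.
  by apply: mulr_ge0; [apply: exprn_ge0; exact: ler0n | exact: sqr_ge0].
have y0 : 0 < x^-1 by rewrite invr_gt0.
have := expR_dominates_power n.+1 (ltW y0).
rewrite expRN ler_pdivrMr ?expR_gt0// => H.
rewrite mulrAC -(ler_pM2r (exprn_gt0 2 y0)).
rewrite -exprD addn2 -[X in _ <= X]mulrA -exprMn divff ?gt_eqF//.
by rewrite expr1n mulr1.
Qed.

Lemma is_derive_inv_power n (x : R) : x != 0 ->
  is_derive x 1 (fun y => y^-1 ^+ n) (- n%:R * x^-1 ^+ n.+1).
Proof.
move=> x0; have dV : is_derive x 1 (fun y : R => y^-1) (- x ^- 2 *: 1).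
  exact: (is_deriveV (f := fun y => y) x0 (is_derive_idR x)).
elim: n => [|n IH]; first by rewrite oppr0 mul0r; exact: is_derive_cstR.
have := is_derive_mulR dV IH; rewrite (_ : (fun y : R => _) = (fun y => y^-1 ^+ n.+1)); last first.
  by apply/funext => y; rewrite exprS.
move=> H; apply: is_derive_eq H _.
by rewrite -exprVn /GRing.scale/= !exprS -natr1; ring.
Qed.

Lemma is_derive_flat n (x : R) :
  is_derive x 1 (flat n) (flat n.+2 x + - n%:R * flat n.+1 x).
Proof.
have [x0|x0|->] := ltgtP x 0.
- rewrite !flat_le0 ?(ltW x0)// mulr0 addr0.
  apply: near_eq_is_derive (is_derive_cstR 0 x).
  by near=> y; rewrite flat_le0//; near: y; exact: lt_le_nbhsl.
- have xn : x != 0 by rewrite gt_eqF.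
  have dV : is_derive x 1 (fun y : R => - y^-1) (- (- x ^- 2 *: 1)).
    exact: is_deriveN (is_deriveV (f := fun y => y) xn (is_derive_idR x)).
  have dE := @is_derive_compR _ expR (fun y => - y^-1) x _ _ (is_derive_expR _) dV.
  have := near_eq_is_derive (g := flat n) _ (is_derive_mulR (is_derive_inv_power n xn) dE).
  move=> H; apply: is_derive_eq.
    apply: H; near=> y; rewrite /flat ifT//; near: y; exact: lt_nbhsr.
  by rewrite /flat x0 -exprVn /GRing.scale/= !exprS; ring.
- rewrite !flat_le0// mulr0 addr0.
  apply: (@is_derive0_quadratic _ (n.+2%:R ^+ n.+2)); first exact: flat_le0.
  exact: flat_quadratic.
Unshelve. all: by end_near. Qed.

Lemma diff_upto_flat k n : diff_upto k (flat n).
Proof.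
elim: k n => // k IH n.
apply: diff_uptoS (@is_derive_flat n) _.
by apply: diff_upto_add; [exact: IH | apply: diff_upto_scale; exact: IH].
Qed.

(** The identity times a smooth step from 0 to 1 on [0, 1]. Its second derivative, rescaled, serves
    as mollifier below. The form [-1 * x + 1] fits [diff_upto_affine]. *)
Definition ramp (x : R) : R := x * (flat 0 x * (flat 0 x + flat 0 (-1 * x + 1))^-1).

Lemma ramp_den_gt0 (x : R) : 0 < flat 0 x + flat 0 (-1 * x + 1).
Proof.
have [x0|x0] := ltP 0 x; first by rewrite ltr_pwDl ?flat_gt0 ?flat_ge0.
by rewrite ltr_wpDl ?flat_ge0// flat_gt0//; lra.
Qed.

Lemma diff_upto_ramp n : diff_upto n ramp.
Proof.
apply: diff_upto_mul; first exact: diff_upto_id.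
apply: diff_upto_mul; first exact: diff_upto_flat.
apply: diff_upto_inv => [x|]; first by rewrite gt_eqF ?ramp_den_gt0.
apply: diff_upto_add; first exact: diff_upto_flat.
by apply: diff_upto_affine; exact: diff_upto_flat.
Qed.

Lemma ramp_le0 (x : R) : x <= 0 -> ramp x = 0.
Proof. by move=> x0; rewrite /ramp flat_le0// mul0r mulr0. Qed.

Lemma ramp_ge1 (x : R) : 1 <= x -> ramp x = x.
Proof.
move=> x1; have := ramp_den_gt0 x; rewrite /ramp (@flat_le0 0 (-1 * x + 1)); last lra.
by rewrite addr0 => ?; rewrite divff ?gt_eqF// mulr1.
Qed.

Lemma is_derive_near_eq f g (x l : R) : (\near x, f x = g x) ->
  is_derive x 1 f (derive1 f x) -> is_derive x 1 g l -> derive1 f x = l.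
Proof.
move=> fg df dg; have := near_eq_is_derive fg df => dg'.
by case: dg => _ <-; case: dg' => _ <-.
Qed.

End SmoothFunctions.

(* A section variable, because conversion would otherwise unfold [ramp]. *)
Section RampDerivatives.
Variables (R : realType) (ramp : R -> R).
Hypothesis ramp_smooth : forall n, diff_upto n ramp.
Hypothesis ramp_le0 : forall x, x <= 0 -> ramp x = 0.
Hypothesis ramp_ge1 : forall x, 1 <= x -> ramp x = x.
Implicit Types x : R.

Lemma is_derive_ramp x : is_derive x 1 ramp (derive1 ramp x).
Proof. exact: diff_uptoS_is_derive (ramp_smooth 1) x. Qed.

Lemma is_derive_ramp1 x :
  is_derive x 1 (derive1 ramp) (derive1n 2 ramp x).
Proof. by have [_ H] := ramp_smooth 2; exact: (@diff_uptoS_is_derive _ 0 _ H x). Qed.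

Lemma continuous_ramp2 : continuous (derive1n 2 ramp).
Proof.
have [_ [_ H]] := ramp_smooth 3; move=> x.
exact: is_derive_continuous (@diff_uptoS_is_derive _ 0 _ H x).
Qed.

Lemma ramp1_lt0 (x : R) : x < 0 -> derive1 ramp x = 0.
Proof.
move=> x0; apply: (is_derive_near_eq (g := fun=> 0)) (is_derive_ramp x) (is_derive_cstR _ _).
by near=> y; apply: ramp_le0; near: y; exact: lt_le_nbhsl.
Unshelve. all: by end_near. Qed.

Lemma ramp1_gt1 (x : R) : 1 < x -> derive1 ramp x = 1.
Proof.
move=> x0; apply: (is_derive_near_eq (g := fun y => y)) (is_derive_ramp x) (is_derive_idR _).
by near=> y; apply: ramp_ge1; near: y; exact: lt_le_nbhsr.
Unshelve. all: by end_near. Qed.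

Lemma ramp2_lt0 (x : R) : x < 0 -> derive1n 2 ramp x = 0.
Proof.
move=> x0; apply: (is_derive_near_eq (g := fun=> 0)) (is_derive_ramp1 x) (is_derive_cstR _ _).
by near=> y; apply: ramp1_lt0; near: y; exact: lt_nbhsl.
Unshelve. all: by end_near. Qed.

Lemma ramp2_gt1 (x : R) : 1 < x -> derive1n 2 ramp x = 0.
Proof.
move=> x0; apply: (is_derive_near_eq (g := fun=> 1)) (is_derive_ramp1 x) (is_derive_cstR _ _).
by near=> y; apply: ramp1_gt1; near: y; exact: lt_nbhsr.
Unshelve. all: by end_near. Qed.

(** The second derivative is continuous and vanishes off the compact interval [0, 1], [ramp] being
    affine on either side. *)
Lemma ramp2_bounded : exists B, 0 <= B /\ forall x, `|derive1n 2 ramp x| <= B.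
Proof.
have cn : {within `[0, 1], continuous (fun x => `|derive1n 2 ramp x|)}.
  by apply: continuous_subspaceT => x; apply: cvg_norm; exact: continuous_ramp2.
have [c _ Hc] := EVT_max ler01 cn.
exists `|derive1n 2 ramp c|; split; first exact: normr_ge0.
move=> x.
have [x0|x0] := ltP x 0; first by rewrite ramp2_lt0// normr0.
have [x1|x1] := ltP 1 x; first by rewrite ramp2_gt1// normr0.
by apply: Hc; rewrite in_itv/= x0 x1.
Qed.

End RampDerivatives.

(** * Integrals and primitives of continuous functions *)

Section WeakSolutions.
Variable R : realType.
Local Notation mu := (@lebesgue_measure R).
Implicit Types (f g F Phi : R -> R) (a b x t : R).

Lemma continuous_mulR (u v : R -> R) : continuous u -> continuous v ->
  continuous (fun x => u x * v x).
Proof. by move=> cu cv x; apply: cvgM; [exact: cu | exact: cv]. Qed.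

Lemma continuous_addR (u v : R -> R) : continuous u -> continuous v ->
  continuous (fun x => u x + v x).
Proof. by move=> cu cv x; apply: cvgD; [exact: cu | exact: cv]. Qed.

Lemma continuous_subR (u v : R -> R) : continuous u -> continuous v ->
  continuous (fun x => u x - v x).
Proof. by move=> cu cv x; apply: cvgB; [exact: cu | exact: cv]. Qed.

Lemma continuous_scaleR (k : R) (u : R -> R) : continuous u ->
  continuous (fun x => k * u x).
Proof. by move=> cu; apply: continuous_mulR => // x; exact: cvg_cst. Qed.

Lemma continuous_integrable f a b : continuous f ->
  mu.-integrable `[a, b] (EFin \o f).
Proof.
move=> cf; apply: continuous_compact_integrable; first exact: segment_compact.
exact: continuous_subspaceT.
Qed.

Lemma continuous_RintegralD f g a b : continuous f -> continuous g ->
  Rintegral mu `[a, b] (fun x => f x + g x) =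
  Rintegral mu `[a, b] f + Rintegral mu `[a, b] g.
Proof. by move=> cf cg; rewrite RintegralD//; exact: continuous_integrable. Qed.

Lemma continuous_RintegralB f g a b : continuous f -> continuous g ->
  Rintegral mu `[a, b] (fun x => f x - g x) =
  Rintegral mu `[a, b] f - Rintegral mu `[a, b] g.
Proof. by move=> cf cg; rewrite RintegralB//; exact: continuous_integrable. Qed.

Lemma continuous_RintegralZ f a b (k : R) : continuous f ->
  Rintegral mu `[a, b] (fun x => k * f x) = k * Rintegral mu `[a, b] f.
Proof. by move=> cf; rewrite RintegralZl//; exact: continuous_integrable. Qed.

Lemma continuous_Rintegral_comb (F f0 f1 f2 : R -> R) a b (k1 k2 : R) :
  continuous F -> continuous f0 -> continuous f1 -> continuous f2 ->
  Rintegral mu `[a, b] (fun x => F x * (f0 x + (k1 * f1 x + k2 * f2 x))) =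
  Rintegral mu `[a, b] (fun x => F x * f0 x)
  + (k1 * Rintegral mu `[a, b] (fun x => F x * f1 x)
  + k2 * Rintegral mu `[a, b] (fun x => F x * f2 x)).
Proof.
move=> cF c0 c1 c2.
have cM g : continuous g -> continuous (fun x => F x * g x).
  by move=> cg x; apply: cvgM; [exact: cF | exact: cg].
have cZ g k : continuous g -> continuous (fun x => k * (F x * g x)).
  by move=> cg x; apply: cvgM; [exact: cvg_cst | exact: cM].
have cD : continuous (fun x => k1 * (F x * f1 x) + k2 * (F x * f2 x)).
  by move=> x; apply: cvgD; exact: cZ.
rewrite -(continuous_RintegralZ a b k1 (cM _ c1)).
rewrite -(continuous_RintegralZ a b k2 (cM _ c2)).
rewrite -(continuous_RintegralD a b (cZ _ _ c1) (cZ _ _ c2)).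
rewrite -(continuous_RintegralD a b (cM _ c0) cD).
by apply: eq_Rintegral => x _; ring.
Qed.

Lemma Rintegral_support f a b : (forall x, x < a \/ b < x -> f x = 0) ->
  Rintegral mu setT f = Rintegral mu `[a, b] f.
Proof.
move=> f0; rewrite [RHS]Rintegral_mkcond; apply: eq_Rintegral => x _.
rewrite patchE; case: ifPn => // /negP; rewrite inE/= in_itv/= => xab.
apply: f0; apply: contrapT => /not_orP[/negP xa /negP bx]; apply: xab.
by move: xa bx; rewrite -!leNgt => -> ->.
Qed.

Lemma Rintegral_FTC2 f F a b : a < b -> continuous f ->
  (forall x, a <= x <= b -> is_derive x 1 F (f x)) ->
  Rintegral mu `[a, b] f = F b - F a.
Proof.
move=> ab cf dF.
have cF x : a <= x <= b -> {for x, continuous F}.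
  by move=> /dF; exact: is_derive_continuous.
rewrite /Rintegral (@continuous_FTC2 _ _ F)//.
- exact: continuous_subspaceT.
- split.
  + move=> x; rewrite in_itv/= => /andP[ax xb].
    by have [] := dF x; rewrite ?(ltW ax) ?(ltW xb).
  + by apply: cvg_at_right_filter; apply: cF; rewrite lexx ltW.
  + by apply: cvg_at_left_filter; apply: cF; rewrite lexx ltW.
- move=> x; rewrite in_itv/= => /andP[ax xb]; rewrite derive1E.
  by have [] := dF x; rewrite ?(ltW ax) ?(ltW xb).
Qed.

Lemma continuous_primitive f a : continuous f ->
  exists F, continuous F /\ forall x, a < x -> is_derive x 1 F (f x).
Proof.
(* Starting the integral at a - 1 makes [F0] differentiable on a neighbourhood of [a, +oo); freezing
   its argument below [a] then yields continuity on the whole line. *)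
move=> cf; pose F0 x := (\int[mu]_(t in `[(a - 1)%R, x]) f t)%R.
have dF0 x : a - 1 < x -> is_derive x 1 F0 (f x).
  move=> ax; have xu : x < x + 1 by rewrite ltrDl.
  have [d e] := continuous_FTC1_closed xu (@continuous_integrable _ _ _ cf) ax (cf x).
  exact: DeriveDef d (etrans (esym (derive1E _ _)) e).
exists (fun x => F0 (Num.max x a)); split => [x|x ax].
  apply: (@continuous_comp _ _ _ (fun x => Num.max x a) F0).
    by apply: continuous_max; [exact: cvg_id | exact: cvg_cst].
  apply: (is_derive_continuous (dF0 _ _)).
  by rewrite lt_max; apply/orP; right; rewrite ltrBlDr ltrDl.
have ax1 : a - 1 < x by apply: lt_trans ax; rewrite ltrBlDr ltrDl.
apply: near_eq_is_derive (dF0 _ ax1).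
near=> y; rewrite max_l//; near: y; exact: lt_le_nbhsr.
Unshelve. all: by end_near. Qed.

(** Transfers an affine relation from the mollified values [j0], [j1], [j2] to the true ones, with
    an error that vanishes with [d]. *)
Lemma affine_relation_approx (p0 p1 p2 j0 j1 j2 l d : R) :
  `|j0 - p0| <= d -> `|j1 - p1| <= d -> `|j2 - p2| <= d ->
  j0 = (1 - l) * j1 + l * j2 ->
  `|p0 - ((1 - l) * p1 + l * p2)| <= d * (1 + (`|1 - l| + `|l|)).
Proof.
move=> H0 H1 H2 E.
have -> : p0 - ((1 - l) * p1 + l * p2) =
    - (j0 - p0) + ((1 - l) * (j1 - p1) + l * (j2 - p2)) by rewrite E; ring.
have -> : d * (1 + (`|1 - l| + `|l|)) = d + (`|1 - l| * d + `|l| * d) by ring.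
apply: le_trans (ler_normD _ _) _; rewrite normrN; apply: lerD => //.
apply: le_trans (ler_normD _ _) _; rewrite !normrM.
by apply: lerD; exact: ler_wpM2l.
Qed.

End WeakSolutions.

(** * Regularity of weak solutions by mollification (du Bois-Reymond) *)

Section Mollifier.
Variables (R : realType) (ramp : R -> R).
Local Notation mu := (@lebesgue_measure R).
Hypothesis ramp_smooth : forall n, diff_upto n ramp.
Hypothesis ramp_le0 : forall x, x <= 0 -> ramp x = 0.
Hypothesis ramp_ge1 : forall x, 1 <= x -> ramp x = x.
Implicit Types (e a x : R).

(** A smooth approximation of max(0, x - a), bent only on [a, a + e]; [hinge1] and [hinge2] are its
    first two derivatives, and [hinge2 e a] is an approximate identity at [a] as [e] tends to 0. *)
Definition hinge e a x := e * ramp (e^-1 * x + - (a / e)).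
Definition hinge1 e a x := derive1 ramp (e^-1 * x + - (a / e)).
Definition hinge2 e a x := e^-1 * derive1n 2 ramp (e^-1 * x + - (a / e)).

Lemma is_derive_hinge e a x : 0 < e -> is_derive x 1 (hinge e a) (hinge1 e a x).
Proof.
move=> e0; have d := is_derive_affine (is_derive_ramp ramp_smooth (e^-1 * x + - (a / e))).
apply: is_derive_eq (is_derive_scaleR e d) _.
by rewrite mulrA divff ?gt_eqF// mul1r.
Qed.

Lemma is_derive_hinge1 e a x : is_derive x 1 (hinge1 e a) (hinge2 e a x).
Proof. exact: is_derive_affine (is_derive_ramp1 ramp_smooth _). Qed.

Lemma continuous_hinge2 e a : continuous (hinge2 e a).
Proof.
move=> x; apply: cvgM; first exact: cvg_cst.
apply: (@continuous_comp _ _ _ (fun x => e^-1 * x + - (a / e)) (derive1n 2 ramp)).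
  by apply: cvgD; [apply: cvgM; [exact: cvg_cst | exact: cvg_id] | exact: cvg_cst].
exact: (continuous_ramp2 ramp_smooth).
Qed.

Lemma diff_upto_hinge n e a : diff_upto n (hinge e a).
Proof. by apply: diff_upto_scale; apply: diff_upto_affine. Qed.

Let argE e a x : e^-1 * x + - (a / e) = (x - a) / e.
Proof. by rewrite mulrC -mulrBl. Qed.

Lemma hinge_left e a x : 0 < e -> x < a ->
  [/\ hinge e a x = 0, hinge1 e a x = 0 & hinge2 e a x = 0].
Proof.
move=> e0 xa; have h : e^-1 * x + - (a / e) < 0.
  by rewrite argE pmulr_llt0 ?invr_gt0// subr_lt0.
rewrite /hinge /hinge1 /hinge2 ramp_le0 ?(ltW h)// mulr0.
rewrite (ramp1_lt0 ramp_smooth ramp_le0 h).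
by rewrite (ramp2_lt0 ramp_smooth ramp_le0 h) mulr0.
Qed.

Lemma hinge_right e a x : 0 < e -> a + e < x ->
  [/\ hinge e a x = x - a, hinge1 e a x = 1 & hinge2 e a x = 0].
Proof.
move=> e0 xa; have h : 1 < e^-1 * x + - (a / e).
  by rewrite argE ltr_pdivlMr// mul1r ltrBrDl.
rewrite /hinge /hinge1 /hinge2 ramp_ge1 ?(ltW h)//.
rewrite (ramp1_gt1 ramp_smooth ramp_ge1 h).
rewrite (ramp2_gt1 ramp_smooth ramp_ge1 h) mulr0; split => //.
by rewrite argE mulrC divfK// gt_eqF.
Qed.

(** The kernel [hinge2 e a] has mass 1, because [hinge1] rises from 0 to 1, and is bounded by B / e;
    a window of length 3 e gives K = 3 B. *)
Lemma hinge2_mollifies : exists K, 0 <= K /\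
  forall (Phi : R -> R) a e d, continuous Phi -> 0 < e -> 0 <= d ->
    (forall x, a - e <= x <= a + 2 * e -> `|Phi x - Phi a| <= d) ->
    `|Rintegral mu setT (fun x => Phi x * hinge2 e a x) - Phi a| <= K * d.
Proof.
have [B [B0 HB]] := ramp2_bounded ramp_smooth ramp_le0 ramp_ge1.
exists (3 * B); split; first by rewrite mulr_ge0.
move=> Phi a e d cPhi e0 d0 Hd.
have ab : a - e < a + 2 * e by lra.
rewrite (@Rintegral_support _ _ (a - e) (a + 2 * e)); last first.
  move=> x [xa|ax].
    by have [|_ _ ->] := @hinge_left e a x e0; [lra | rewrite mulr0].
  by have [|_ _ ->] := @hinge_right e a x e0; [lra | rewrite mulr0].
have I1 : Rintegral mu `[a - e, a + 2 * e] (hinge2 e a) = 1.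
  have -> := Rintegral_FTC2 ab (@continuous_hinge2 e a)
    (fun x _ => is_derive_hinge1 e a x).
  have [|_ -> _] := @hinge_right e a (a + 2 * e) e0; first lra.
  have [|_ -> _] := @hinge_left e a (a - e) e0; first lra.
  by rewrite subr0.
have ch := @continuous_hinge2 e a.
have ce : continuous (fun x => Phi x * hinge2 e a x).
  by move=> x; apply: cvgM; [exact: cPhi | exact: ch].
have cd : continuous (fun x => Phi a * hinge2 e a x).
  by move=> x; apply: cvgM; [exact: cvg_cst | exact: ch].
have cf : continuous (fun x => (Phi x - Phi a) * hinge2 e a x).
  by move=> x; apply: cvgM; [apply: cvgB; [exact: cPhi | exact: cvg_cst] | exact: ch].
have -> : Rintegral mu `[a - e, a + 2 * e] (fun x => Phi x * hinge2 e a x) - Phi a =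
  Rintegral mu `[a - e, a + 2 * e] (fun x => (Phi x - Phi a) * hinge2 e a x).
  have := continuous_RintegralB (a - e) (a + 2 * e) ce cd.
  rewrite (continuous_RintegralZ (a - e) (a + 2 * e) (Phi a) ch) I1 mulr1 => <-.
  by apply: eq_Rintegral => x _; rewrite mulrBl.
apply: le_trans (le_normr_Rintegral _ _) _ => //; first exact: continuous_integrable.
have -> : 3 * B * d = Rintegral mu `[a - e, a + 2 * e] (fun=> d * (B / e)).
  rewrite Rintegral_cst//= lebesgue_measure_itv/= lte_fin ab -EFinB /=.
  by field; rewrite gt_eqF.
apply: le_Rintegral => //.
- apply: continuous_integrable => x; apply: cvg_norm; exact: cf.
- by apply: continuous_integrable => x; exact: cvg_cst.
move=> x; rewrite /= in_itv/= => xab.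
rewrite normrM; apply: ler_pM => //; first exact: Hd.
have ei : 0 <= e^-1 by rewrite invr_ge0 ltW.
by rewrite /hinge2 normrM (ger0_norm ei) mulrC; apply: ler_wpM2r.
Qed.

Variables (A D c : R) (w f g : R -> R).
Hypotheses (D0 : 0 < D) (cw : continuous w) (cf : continuous f) (cg : continuous g).
Hypothesis weak_eq : forall chi, test_fun chi ->
  - c * Rintegral mu setT (fun t => f t * derive1 chi t)
  = D * Rintegral mu setT (fun t => w t * derive1n 2 chi t)
    - Rintegral mu setT (fun t => g t * chi t).

Variables (P G1 G2 : R -> R).
Hypotheses (cP : continuous P) (cG2 : continuous G2).
Hypothesis dP : forall x, A < x -> is_derive x 1 P (f x).
Hypothesis dG1 : forall x, A < x -> is_derive x 1 G1 (g x).
Hypothesis dG2 : forall x, A < x -> is_derive x 1 G2 (G1 x).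

(** Since P' = f and G2'' = g on (A, +oo), the weak equation says that the second distributional
    derivative of [Phi] vanishes there. *)
Let Phi x := D * w x - c * P x - G2 x.

(* Two integrations by parts move all derivatives onto the test function. *)
Lemma weak_second_derivative0 (chi chi1 chi2 : R -> R) (a b : R) :
  A < a -> a < b -> (forall n, diff_upto n chi) ->
  (forall x, is_derive x 1 chi (chi1 x)) ->
  (forall x, is_derive x 1 chi1 (chi2 x)) -> continuous chi2 ->
  (forall x, x <= a \/ b <= x -> [/\ chi x = 0, chi1 x = 0 & chi2 x = 0]) ->
  Rintegral mu `[a, b] (fun x => Phi x * chi2 x) = 0.
Proof.
move=> Aa ab schi d1 d2 cchi2 supp.
have cchi : continuous chi by move=> x; exact: is_derive_continuous (d1 x).
have cchi1 : continuous chi1 by move=> x; exact: is_derive_continuous (d2 x).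
have E1 : derive1 chi = chi1 by exact: is_derive_derive1.
have E2 : derive1n 2 chi = chi2.
  by rewrite -(is_derive_derive1 d2) -E1.
have tchi : test_fun chi.
  split; first exact: diff_upto_derive1n.
  exists (`|a| + `|b|) => x Hx; have [] // := supp x.
  have [xa|ax] := leP x a; [by left | right].
  rewrite leNgt; apply/negP => xb; move: Hx; rewrite ltNge => /negP; apply.
  rewrite ler_norml; apply/andP; split.
    have := ler_norm (- a); rewrite normrN; have := normr_ge0 b; lra.
  have := ler_norm b; have := normr_ge0 a; lra.
have := weak_eq tchi; rewrite E1 E2.
have S x : x < a \/ b < x -> [/\ chi x = 0, chi1 x = 0 & chi2 x = 0].
  by move=> H; apply: supp; case: H => /ltW; [left | right].
rewrite !(@Rintegral_support _ _ a b); [|by move=> x /S[H0 H1 H2]; rewrite ?H0 ?H1 ?H2 ?mulr0..].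
move=> W.
have [sa1 sa2 _] := supp a (or_introl (lexx a)).
have [sb1 sb2 _] := supp b (or_intror (lexx b)).
have I1 : Rintegral mu `[a, b] (fun x => P x * chi2 x) +
    Rintegral mu `[a, b] (fun x => chi1 x * f x) = 0.
  rewrite -continuous_RintegralD; [|exact: continuous_mulR..].
  have := @Rintegral_FTC2 _ (fun x => P x * chi2 x + chi1 x * f x)
    (fun x => P x * chi1 x) a b ab; rewrite sa2 sb2 !mulr0 subrr; apply.
    by apply: continuous_addR; exact: continuous_mulR.
  by move=> x /andP[ax _]; exact: is_derive_mulR (dP (lt_le_trans Aa ax)) (d2 x).
have I2 : Rintegral mu `[a, b] (fun x => g x * chi x) -
    Rintegral mu `[a, b] (fun x => G2 x * chi2 x) = 0.
  rewrite -continuous_RintegralB; [|exact: continuous_mulR..].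
  (* In the derivative of G1 chi - G2 chi1 the mixed terms G1 chi1 cancel, so both integrations by
     parts for [g] are done at once. *)
  have := @Rintegral_FTC2 _ (fun x => g x * chi x - G2 x * chi2 x)
    (fun x => G1 x * chi x - G2 x * chi1 x) a b ab.
  rewrite sa1 sb1 sa2 sb2 !mulr0 !subrr; apply.
    by apply: continuous_subR; exact: continuous_mulR.
  move=> x /andP[ax _]; have Ax := lt_le_trans Aa ax.
  apply: is_derive_eq (is_derive_addR (is_derive_mulR (dG1 Ax) (d1 x))
    (is_deriveN (is_derive_mulR (dG2 Ax) (d2 x)))) _.
  by ring.
have -> : Rintegral mu `[a, b] (fun x => Phi x * chi2 x) =
    D * Rintegral mu `[a, b] (fun x => w x * chi2 x)
    - c * Rintegral mu `[a, b] (fun x => P x * chi2 x)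
    - Rintegral mu `[a, b] (fun x => G2 x * chi2 x).
  rewrite -!continuous_RintegralZ; [|exact: continuous_mulR..].
  rewrite -!continuous_RintegralB;
    [|by repeat first [exact: continuous_mulR | apply: continuous_subR | apply: continuous_scaleR]..].
  by apply: eq_Rintegral => x _; rewrite /Phi; ring.
have I3 : Rintegral mu `[a, b] (fun x => chi1 x * f x) =
  Rintegral mu `[a, b] (fun x => f x * chi1 x).
  by apply: eq_Rintegral => x _; rewrite mulrC.
move: I1 I2 W; rewrite I3.
set i1 := Rintegral _ _ _; set i2 := Rintegral _ _ _; set i3 := Rintegral _ _ _.
set i4 := Rintegral _ _ _; set i5 := Rintegral _ _ _.
move=> /eqP; rewrite addr_eq0 => /eqP -> /eqP; rewrite subr_eq0 => /eqP -> W.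
by rewrite mulrN opprK -[X in _ + X - _]opprK -mulNr W; ring.
Qed.

Lemma hinge2_Rintegral e y a b : 0 < e -> a < y -> y + e < b ->
  Rintegral mu setT (fun x => Phi x * hinge2 e y x) =
  Rintegral mu `[a, b] (fun x => Phi x * hinge2 e y x).
Proof.
move=> e0 ay yb; apply: Rintegral_support => x [xa|bx].
  by have [|_ _ ->] := @hinge_left e y x e0; [lra | rewrite mulr0].
by have [|_ _ ->] := @hinge_right e y x e0; [lra | rewrite mulr0].
Qed.

Lemma continuous_Phi : continuous Phi.
Proof.
apply: continuous_subR => //; apply: continuous_subR; exact: continuous_scaleR.
Qed.

Definition mollified e z := Rintegral mu setT (fun x => Phi x * hinge2 e z x).

Lemma mollified_cvg z d : 0 < d -> exists2 r, 0 < r &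
  forall e, 0 < e -> e <= r -> `|mollified e z - Phi z| <= d.
Proof.
move=> d0; have [K [K0 HK]] := hinge2_mollifies.
have K1 : 0 < K + 1 by rewrite ltr_wpDl.
have d'0 : 0 < d / (K + 1) by rewrite divr_gt0.
have /cvgrPdist_le/(_ _ d'0)/nbhs_ballP[r /= r0 Hr] := @continuous_Phi z.
exists (r / 3) => [|e e0 er]; first by rewrite divr_gt0.
apply: (@le_trans _ _ (K * (d / (K + 1)))).
  apply: HK => //; [exact: continuous_Phi | exact: ltW |].
  move=> x /andP[x1 x2]; rewrite distrC; apply: Hr.
  by rewrite /ball/= ltr_norml; apply/andP; split; lra.
rewrite mulrA ler_pdivrMr// mulrC; apply: ler_wpM2l; first exact: ltW.
by rewrite lerDl.
Qed.

(* For weights of total mass 0 and first moment 0, a combination of hinges has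
   compact support. *)
Lemma mollified_affine e y l a b : 0 < e -> A < a -> a < y -> a < A + 1 ->
  y + e < b -> A + 2 + e < b -> y = A + 1 + l ->
  mollified e y = (1 - l) * mollified e (A + 1) + l * mollified e (A + 2).
Proof.
move=> e0 Aa ay aA yb Ab yE.
have a2 : a < A + 2 by lra.
have b1 : A + 1 + e < b by lra.
have ab : a < b by lra.
pose chi x := hinge e y x + (- (1 - l) * hinge e (A + 1) x + - l * hinge e (A + 2) x).
pose chi1 x := hinge1 e y x + (- (1 - l) * hinge1 e (A + 1) x + - l * hinge1 e (A + 2) x).
pose chi2 x := hinge2 e y x + (- (1 - l) * hinge2 e (A + 1) x + - l * hinge2 e (A + 2) x).
have s1 n : diff_upto n chi.
  apply: diff_upto_add; first exact: diff_upto_hinge.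
  by apply: diff_upto_add; apply: diff_upto_scale; exact: diff_upto_hinge.
have s2 x : is_derive x 1 chi (chi1 x).
  exact: is_derive_addR (is_derive_hinge _ _ e0) (is_derive_addR
    (is_derive_scaleR _ (is_derive_hinge _ _ e0))
    (is_derive_scaleR _ (is_derive_hinge _ _ e0))).
have s3 x : is_derive x 1 chi1 (chi2 x).
  exact: is_derive_addR (is_derive_hinge1 _ _ _) (is_derive_addR
    (is_derive_scaleR _ (is_derive_hinge1 _ _ _))
    (is_derive_scaleR _ (is_derive_hinge1 _ _ _))).
have s4 : continuous chi2.
  apply: continuous_addR; first exact: continuous_hinge2.
  by apply: continuous_addR; apply: continuous_scaleR; exact: continuous_hinge2.
have s5 x : x <= a \/ b <= x -> [/\ chi x = 0, chi1 x = 0 & chi2 x = 0].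
  move=> [xa|bx]; rewrite /chi /chi1 /chi2.
    have [-> -> ->] := hinge_left e0 (le_lt_trans xa ay).
    have [-> -> ->] := hinge_left e0 (le_lt_trans xa aA).
    have [-> -> ->] := hinge_left e0 (le_lt_trans xa a2).
    by rewrite !mulr0 !addr0.
  have [-> -> ->] := hinge_right e0 (lt_le_trans yb bx).
  have [-> -> ->] := hinge_right e0 (lt_le_trans b1 bx).
  have [-> -> ->] := hinge_right e0 (lt_le_trans Ab bx).
  by rewrite yE; split; ring.
have H := weak_second_derivative0 Aa ab s1 s2 s3 s4 s5.
have E := continuous_Rintegral_comb a b (- (1 - l)) (- l) continuous_Phi
  (@continuous_hinge2 e y) (@continuous_hinge2 e (A + 1)) (@continuous_hinge2 e (A + 2)).
have solve (i0 i1 i2 : R) :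
    i0 + (- (1 - l) * i1 + - l * i2) = 0 -> i0 = (1 - l) * i1 + l * i2.
  by move=> H0; apply/eqP; rewrite -subr_eq0 -H0; apply/eqP; ring.
have := f_equal2 (fun u v => (1 - l) * u + l * v)
  (esym (hinge2_Rintegral e0 aA b1)) (esym (hinge2_Rintegral e0 a2 Ab)).
apply: etrans; apply: (etrans (hinge2_Rintegral e0 ay yb)).
exact: solve (etrans (esym E) H).
Qed.

(** The limit e -> 0 in [mollified_affine]: [Phi] is the line through its values at A + 1 and A +
    2. *)
Lemma weak_second_derivative0_affine y : A < y ->
  Phi y = (1 - (y - A - 1)) * Phi (A + 1) + (y - A - 1) * Phi (A + 2).
Proof.
move=> Ay; have [l lE] : exists l, l = y - A - 1 by exists (y - A - 1).
rewrite -lE; have yE : y = A + 1 + l by rewrite lE; ring.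
apply/eqP; rewrite -subr_eq0 -normr_le0; apply/ler_addgt0Pr => d d0; rewrite add0r.
have M0 : 0 < 1 + (`|1 - l| + `|l|) by rewrite ltr_pwDl// addr_ge0.
have d'0 := divr_gt0 d0 M0.
have [r0 r00 Hr0] := mollified_cvg y d'0.
have [r1 r10 Hr1] := mollified_cvg (A + 1) d'0.
have [r2 r20 Hr2] := mollified_cvg (A + 2) d'0.
have [e [e0 er0 er1 er2]] : exists e, [/\ 0 < e, e <= r0, e <= r1 & e <= r2].
  exists (Num.min r0 (Num.min r1 r2)).
  by rewrite !lt_min r00 r10 r20 !ge_min !lexx !orbT.
have [a [Aa ay aA]] : exists a, [/\ A < a, a < y & a < A + 1].
  exists ((A + Num.min y (A + 1)) / 2).
  have h1 : A < Num.min y (A + 1) by rewrite lt_min Ay ltrDl ltr01.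
  have h2 : Num.min y (A + 1) <= y by rewrite ge_min lexx.
  have h3 : Num.min y (A + 1) <= A + 1 by rewrite ge_min lexx orbT.
  by split; lra.
have [b [yb Ab]] : exists b, y + e < b /\ A + 2 + e < b.
  exists (Num.max y (A + 2) + e + 1).
  have h1 : y <= Num.max y (A + 2) by rewrite le_max lexx.
  have h2 : A + 2 <= Num.max y (A + 2) by rewrite le_max lexx orbT.
  by split; lra.
have H := mollified_affine e0 Aa ay aA yb Ab yE.
have {}Hr0 := Hr0 e e0 er0; have {}Hr1 := Hr1 e e0 er1; have {}Hr2 := Hr2 e e0 er2.
have := affine_relation_approx Hr0 Hr1 Hr2 H.
by rewrite (divfK (lt0r_neq0 M0)).
Qed.

(** Solving the affine formula for [Phi] gives D w = c P + G2 + affine, and the right-hand side is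
    differentiable. The witness is [G1] plus the slope [k] of [Phi]. *)
Lemma weak_solution_regular_aux : exists G, forall t, A < t ->
  is_derive t 1 w ((c * f t + G t) / D) /\ is_derive t 1 G (g t).
Proof.
pose k := Phi (A + 2) - Phi (A + 1).
exists (fun t => G1 t + k) => t At; split; last first.
  by apply: is_derive_eq (is_derive_addR (dG1 At) (is_derive_cstR k t)) _; rewrite addr0.
pose u x := D^-1 * (c * P x + (G2 x + (Phi (A + 1) + (k * (x + (- A - 1)))))).
have du : is_derive t 1 u (D^-1 * (c * f t + (G1 t + (0 + k * (1 + 0))))).
  exact: is_derive_scaleR (is_derive_addR (is_derive_scaleR _ (dP At))
    (is_derive_addR (dG2 At) (is_derive_addR (is_derive_cstR _ _)
    (is_derive_scaleR _ (is_derive_addR (is_derive_idR _) (is_derive_cstR _ _)))))).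
have solve x (p1 p2 : R) :
    D * w x - c * P x - G2 x = (1 - (x - A - 1)) * p1 + (x - A - 1) * p2 ->
    c * P x + (G2 x + (p1 + (p2 - p1) * (x + (- A - 1)))) = D * w x.
  by move=> H; apply/eqP; rewrite eq_sym -subr_eq0 -(subrr (D * w x - c * P x - G2 x)) {2}H;
    apply/eqP; ring.
have uw : \forall x \near t, u x = w x.
  near=> x; have Ax : A < x by near: x; exact: lt_nbhsr.
  have := weak_second_derivative0_affine Ax; rewrite {1}/Phi => H.
  have -> : w x = D^-1 * (D * w x) by rewrite mulrA mulVf ?mul1r// gt_eqF.
  rewrite /u /k; congr (_ * _); exact: solve H.
apply: is_derive_eq (near_eq_is_derive uw du) _.
by rewrite addr0 add0r mulr1 mulrC.
Unshelve. all: by end_near. Qed.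

End Mollifier.

(** The existential hides the closed form of the ramp and leaves only its three properties
    visible. *)
Lemma smooth_ramp_ex (R : realType) : exists ramp : R -> R,
  [/\ forall n, diff_upto n ramp, forall x, x <= 0 -> ramp x = 0 &
      forall x, 1 <= x -> ramp x = x].
Proof.
exists (@ramp R); split; first exact: diff_upto_ramp.
  exact: ramp_le0.
exact: ramp_ge1.
Qed.

Lemma weak_solution_regular (R : realType) (A D c : R) (w f g : R -> R) :
  0 < D -> continuous w -> continuous f -> continuous g ->
  (forall chi, test_fun chi ->
    - c * Rintegral lebesgue_measure setT (fun t => f t * derive1 chi t)
    = D * Rintegral lebesgue_measure setT (fun t => w t * derive1n 2 chi t)
      - Rintegral lebesgue_measure setT (fun t => g t * chi t)) ->
  exists G, forall t, A < t ->
    is_derive t 1 w ((c * f t + G t) / D) /\ is_derive t 1 G (g t).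
Proof.
move=> D0 cw cf cg weak_eq.
have [rho [r1 r2 r3]] := smooth_ramp_ex R.
have [P [cP dP]] := continuous_primitive A cf.
have [G1 [cG1 dG1]] := continuous_primitive A cg.
have [G2 [cG2 dG2]] := continuous_primitive A cG1.
exact: (weak_solution_regular_aux r1 r2 r3 D0 cw cf cg weak_eq cP cG2 dP dG1 dG2).
Qed.


(** * Decay rates of positive solutions of a delayed differential inequality *)

Section DelayInequality.
Variable R : realType.
Variables (v v1 v2 : R -> R) (T h D c0 q0 p0 : R).
Hypotheses (D0 : 0 < D) (h0 : 0 < h) (c00 : 0 <= c0) (q00 : 0 < q0) (p00 : 0 < p0).
Hypothesis dv : forall t, T <= t -> is_derive t 1 v (v1 t).
Hypothesis dv1 : forall t, T <= t -> is_derive t 1 v1 (v2 t).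
Hypothesis v_gt0 : forall t, T <= t -> 0 < v t.
Hypothesis v1_le0 : forall t, T <= t -> v1 t <= 0.
Hypothesis delay_ineq : forall e, 0 < e -> exists T', forall t, T' <= t ->
  (c0 + e) * v1 t + (q0 - e) * v t + (p0 - e) * v (t - h) <= D * v2 t.

(** Says that e^(l t) v(t) is eventually nonincreasing, in differential form. *)
Definition decay_rate (l : R) :=
  exists T', forall t, T' <= t -> v1 t + l * v t <= 0.

Lemma delay_nonincreasing s t : T <= s -> s <= t -> v t <= v s.
Proof.
move=> Ts st; rewrite -lerN2.
apply: (@derive_ge0_le _ (fun y => - v y) (fun y => - v1 y)) => // x /andP[sx _].
  by have Tx := le_trans Ts sx; have := dv Tx => dvx; exact: is_deriveN.
by rewrite oppr_ge0; apply: v1_le0; exact: le_trans sx.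
Qed.

Lemma decay_rateP l : decay_rate l ->
  exists T', forall s t, T' <= s -> s <= t -> expR (l * (t - s)) * v t <= v s.
Proof.
move=> [T' HT']; exists (Num.max T T') => s t; rewrite ge_max => /andP[Ts T's] st.
have : - (expR (l * s) * v s) <= - (expR (l * t) * v t).
  apply: (@derive_ge0_le _ (fun y => - (expR (l * y) * v y))
    (fun y => - (expR (l * y) * v1 y + v y * (l * expR (l * y)))) s t st).
    move=> x /andP[sx _].
    exact: is_deriveN (is_derive_mulR (is_derive_expRM l x) (dv (le_trans Ts sx))).
  move=> x /andP[sx _]; have := HT' x (le_trans T's sx) => H.
  rewrite oppr_ge0.
  have -> : expR (l * x) * v1 x + v x * (l * expR (l * x)) =
    expR (l * x) * (v1 x + l * v x) by ring.
  by rewrite mulr_ge0_le0// expR_ge0.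
rewrite lerN2 => H.
have -> : l * (t - s) = l * t - l * s by ring.
rewrite expRD expRN mulrAC.
by rewrite ler_pdivrMr ?expR_gt0// mulrC [leRHS]mulrC mulrC.
Qed.

(* The factorisation [D y' - (C + D l') y = D v'' - C v' - (D l'^2 + C l') v]
   for [y = v' + l' v] makes [y] grow exponentially once it is positive, while
   [y <= l' v] is bounded. *)
Lemma decay_rate_improve e l l' : 0 < e -> 0 <= l' -> e <= p0 -> decay_rate l ->
  D * l' ^+ 2 + (c0 + e) * l' <= (q0 - e) + (p0 - e) * expR (l * h) ->
  decay_rate l'.
Proof.
move=> e0 l'0 ep /decay_rateP[T1 HT1] Hl; have [T2 HT2] := delay_ineq e0.
set T3 := Num.max (Num.max T T2) (T1 + h).
exists T3 => t1; rewrite !ge_max => /andP[/andP[Tt1 T2t1] T1t1].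
rewrite leNgt; apply/negP => y_gt0.
pose y t := v1 t + l' * v t.
pose y1 t := v2 t + l' * v1 t.
(* Growth rate of [y]: with C = c0 + e the factorisation gives D y' >= (C + D l') y from [t1] on. *)
have [r rE] : exists r, r = (c0 + e + D * l') / D by exists ((c0 + e + D * l') / D).
have r0 : 0 < r.
  by rewrite rE; apply: divr_gt0 => //; have := mulr_ge0 (ltW D0) l'0; move: c00 e0; lra.
have dy t : T <= t -> is_derive t 1 y (y1 t).
  by move=> Tt; exact: is_derive_addR (dv1 Tt) (is_derive_scaleR l' (dv Tt)).
have y1y t : t1 <= t -> r * y t <= y1 t.
  move=> t1t.
  have Tt : T <= t by exact: le_trans t1t.
  rewrite rE mulrAC ler_pdivrMr// /y /y1.
  have H2 := HT2 t (le_trans T2t1 t1t).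
  have H1 : expR (l * h) * v t <= v (t - h).
    have := HT1 (t - h) t; rewrite opprB addrCA subrr addr0; apply.
      by rewrite lerBrDr; exact: le_trans t1t.
    by rewrite gerBl ltW.
  have H3 : (p0 - e) * (expR (l * h) * v t) <= (p0 - e) * v (t - h).
    by apply: ler_wpM2l; rewrite ?subr_ge0.
  have H4 := ler_wpM2r (ltW (v_gt0 Tt)) Hl.
  set E := expR _ in H3 H4; set w := v (t - h) in H2 H3.
  lra.
have ymono t : t1 <= t -> y t1 * expR (r * (t - t1)) <= y t.
  move=> t1t.
  have : expR (- r * t1) * y t1 <= expR (- r * t) * y t.
    apply: (@derive_ge0_le _ (fun s => expR (- r * s) * y s) (fun s =>
      expR (- r * s) * y1 s + y s * (- r * expR (- r * s))) t1 t t1t) => x /andP[t1x _].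
      have dyx := dy _ (le_trans Tt1 t1x).
      exact: (is_derive_mulR (is_derive_expRM (- r) x) dyx).
    have -> : expR (- r * x) * y1 x + y x * (- r * expR (- r * x)) =
       expR (- r * x) * (y1 x - r * y x) by ring.
    by rewrite mulr_ge0 ?expR_ge0// subr_ge0 y1y.
  have -> : r * (t - t1) = - r * t1 + r * t by ring.
  move=> /(ler_wpM2r (expR_ge0 (r * t))) H; rewrite expRD mulrA [y t1 * _]mulrC.
  apply: le_trans H _; rewrite mulrAC -expRD.
  by rewrite mulNr addNr expR0 mul1r.
(* At this time e^(r (t - t1)) >= 2 + l' v(t1) / y(t1), so y(t) >= 2 y(t1) + l' v(t1), which exceeds
   the upper bound l' v(t) for y(t). *)
pose t := t1 + (1 + l' * v t1 / y t1) / r.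
have yp : 0 < y t1 by [].
have lv : 0 <= l' * v t1 by rewrite mulr_ge0// ltW// v_gt0.
have t1t : t1 <= t.
  by rewrite lerDl divr_ge0 ?(ltW r0)// addr_ge0// divr_ge0// ltW.
have := ymono t t1t.
have -> : r * (t - t1) = 1 + l' * v t1 / y t1 by rewrite /t; field; rewrite !gt_eqF.
move=> Hy.
have := ler_wpM2l (ltW yp) (expR_ge1Dx (1 + l' * v t1 / y t1)).
have -> : y t1 * (1 + (1 + l' * v t1 / y t1)) = 2 * y t1 + l' * v t1.
  by field; rewrite gt_eqF.
have Tt := le_trans Tt1 t1t.
have := ler_wpM2l l'0 (delay_nonincreasing Tt1 t1t).
have : y t <= l' * v t by rewrite /y gerDr v1_le0.
move: Hy yp; lra.
Qed.

(** Two integrations of D v'' - C v' >= p' v(. - h), over [t, t + h/2] and then over [t, t + h/4];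
    monotonicity of [v] bounds the delayed term from below by its value at the right end of the
    window. *)
Lemma delay_harnack : exists T' K, forall t, T' <= t -> v (t - h / 4) <= K * v t.
Proof.
have e0 : 0 < Num.min (p0 / 2) q0 by rewrite lt_min q00 divr_gt0.
have [T2 HT2] := delay_ineq e0.
set e := Num.min _ _ in e0 HT2.
have e1 : e <= p0 / 2 by rewrite /e ge_min lexx.
have e2 : e <= q0 by rewrite /e ge_min lexx orbT.
have e_p : p0 / 2 <= p0 - e by lra.
have e_q : 0 <= q0 - e by lra.
set C := c0 + e in HT2; have C0 : 0 <= C by rewrite /C addr_ge0// ltW.
set p' := p0 / 2 in e_p; have p'0 : 0 < p' by rewrite divr_gt0.
have ineq t : T + h <= t -> T2 <= t -> C * v1 t + p' * v (t - h) <= D * v2 t.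
  move=> Tt T2t; apply: le_trans (HT2 _ T2t).
  have Tth : T <= t - h by lra.
  have := ler_wpM2r (ltW (v_gt0 Tth)) e_p.
  have Tt' : T <= t by have := h0; lra.
  have := mulr_ge0 e_q (ltW (v_gt0 Tt')).
  by lra.
set T3 := Num.max (T + h) T2.
have T3P t : T3 <= t -> (T + h <= t) /\ (T2 <= t).
  by rewrite ge_max => /andP[].
have step1 t : T3 <= t -> p' * (h / 2) * v (t - h / 2) <= C * v t - D * v1 t.
  move=> T3t; have [Tt T2t] := T3P _ T3t.
  have tth : t <= t + h / 2 by have := h0; lra.
  have := @derive_ge_sub _ (fun s => D * v1 s - C * v s)
    (fun s => D * v2 s - C * v1 s) t (t + h / 2) (p' * v (t - h / 2)) tth.
  have -> : t + h / 2 - t = h / 2 by lra.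
  have Tt2 : T <= t + h / 2 by have := h0; lra.
  have v1D := mulr_ge0_le0 (ltW D0) (v1_le0 Tt2).
  have vC := mulr_ge0 C0 (ltW (v_gt0 Tt2)).
  move=> H; have {}H : p' * v (t - h / 2) * (h / 2) <=
    D * v1 (t + h / 2) - C * v (t + h / 2) - (D * v1 t - C * v t).
    apply: H => x /andP[tx xt].
      have Tx : T <= x by have := h0; lra.
      exact: is_derive_addR (is_derive_scaleR D (dv1 Tx))
        (is_deriveN (is_derive_scaleR C (dv Tx))).
    have := ineq x; move/(_ (le_trans Tt tx) (le_trans T2t tx)).
    have : v (t - h / 2) <= v (x - h) by apply: delay_nonincreasing; lra.
    by move/(ler_wpM2l (ltW p'0)); lra.
  by lra.
exists T3, ((D + C * (h / 4)) / (p' * (h / 2) * (h / 4))) => t T3t.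
have [Tt T2t] := T3P _ T3t.
rewrite mulrAC ler_pdivlMr ?mulr_gt0 ?divr_gt0//.
have tth : t <= t + h / 4 by have := h0; lra.
have := @derive_ge_sub _ (fun s => - (D * v s)) (fun s => - (D * v1 s))
  t (t + h / 4) (p' * (h / 2) * v (t - h / 4) - C * v t) tth.
have -> : t + h / 4 - t = h / 4 by lra.
have Tt4 : T <= t + h / 4 by have := h0; lra.
have := mulr_ge0 (ltW D0) (ltW (v_gt0 Tt4)).
move=> H1 H; have {}H : (p' * (h / 2) * v (t - h / 4) - C * v t) * (h / 4) <=
  - (D * v (t + h / 4)) - - (D * v t).
  apply: H => x /andP[tx xt].
    have Tx : T <= x by have := h0; lra.
    exact: is_deriveN (is_derive_scaleR D (dv Tx)).
  have := step1 x (le_trans T3t tx).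
  have : v (t - h / 4) <= v (x - h / 2) by apply: delay_nonincreasing; have := h0; lra.
  have ph : 0 <= p' * (h / 2) by rewrite mulr_ge0 ?divr_ge0// ltW.
  move/(ler_wpM2l ph).
  have : v x <= v t by apply: delay_nonincreasing; have := h0; lra.
  by move/(ler_wpM2l C0); lra.
by lra.
Qed.

(** A rate [l] forces v(t - h/4) >= e^(l h/4) v(t), so [delay_harnack] gives 1 + l h/4 <= e^(l h/4)
    <= K. *)
Lemma decay_rate_bounded : exists B, forall l, decay_rate l -> l <= B.
Proof.
have [T1 [K HK]] := delay_harnack.
exists (K / (h / 4)) => l /decay_rateP[T2 HT2].
set t := Num.max (Num.max T1 T) T2 + h / 4.
have [T1t Tt T2t] : [/\ T1 <= t, T <= t & T2 <= t - h / 4].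
  have hh : 0 < h / 4 by rewrite divr_gt0.
  rewrite /t addrK; split; last by rewrite le_max lexx orbT.
    by apply: ler_wpDr; [exact: ltW | rewrite !le_max lexx].
  by apply: ler_wpDr; [exact: ltW | rewrite !le_max lexx orbT].
have := HT2 (t - h / 4) t T2t; rewrite gerBl.
move/(_ (ltW (divr_gt0 h0 (ltr0Sn _ 3)))).
have -> : t - (t - h / 4) = h / 4 by ring.
move=> H; have := le_trans H (HK _ T1t).
rewrite ler_pM2r ?v_gt0// => H2.
rewrite ler_pdivlMr ?divr_gt0//; apply: le_trans H2.
by apply: le_trans (expR_ge1Dx _); rewrite lerDr.
Qed.

Lemma delay_inequality_characteristic :
  exists2 l : R, 0 <= l & q0 + p0 * expR (l * h) <= D * l ^+ 2 + c0 * l.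
Proof.
have [B HB] := decay_rate_bounded.
have S0 : decay_rate 0.
  by exists T => t Tt; rewrite mul0r addr0 v1_le0.
have supS : has_sup decay_rate by split; [exists 0 | exists B].
pose ls := sup decay_rate.
have ls0 : 0 <= ls by apply: ub_le_sup => //; exists B.
exists ls => //; rewrite leNgt; apply/negP => Hpos.
(* Positivity of [H e] is what improves a rate above ls - e to the rate ls + e. By continuity it
   persists from e = 0 to some e > 0, against the choice of [ls] as supremum. *)
pose H e := (q0 - e) + (p0 - e) * expR ((ls - e) * h) -
  (D * ((ls + e) * (ls + e)) + (c0 + e) * (ls + e)).
have H0 : 0 < H 0 by rewrite /H !subr0 !addr0 subr_gt0 -expr2.
have cH : {for 0, continuous H}.
  apply: cvgB; last first.
    apply: cvgD; last first.
      by apply: cvgM; apply: cvgD; [exact: cvg_cst| exact: cvg_id| exact: cvg_cst| exact: cvg_id].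
    apply: cvgM; first exact: cvg_cst.
    by apply: cvgM; apply: cvgD; [exact: cvg_cst| exact: cvg_id| exact: cvg_cst| exact: cvg_id].
  apply: cvgD; first by apply: cvgB; [exact: cvg_cst| exact: cvg_id].
  apply: cvgM; first by apply: cvgB; [exact: cvg_cst| exact: cvg_id].
  apply: (@continuous_comp _ _ _ (fun e => (ls - e) * h) expR); last exact: continuous_expR.
  apply: cvgM; last exact: cvg_cst.
  by apply: cvgB; [exact: cvg_cst| exact: cvg_id].
have : \forall e \near 0, 0 < H e by exact: (cvgr_gt (H 0)) cH _ H0.
move=> /nbhs_ballP[d /= d0 Hd].
pose e := Num.min (d / 2) p0.
have e0 : 0 < e by rewrite lt_min p00 divr_gt0.
have ed : e < d.
  by apply: (@le_lt_trans _ _ (d / 2)); [rewrite ge_min lexx | rewrite ltr_pdivrMr// ltr_pMr// ltr1n].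
have He : 0 < H e.
  by apply: Hd; rewrite /ball/= sub0r normrN gtr0_norm.
have [l Sl ll] := sup_adherent e0 supS.
have : decay_rate (ls + e).
  apply: (@decay_rate_improve e l) => //.
  - by rewrite addr_ge0// ltW.
  - by rewrite ge_min lexx orbT.
  - rewrite -subr_ge0; apply: le_trans (ltW He) _; rewrite /H -expr2.
    apply: lerB => //; apply: lerD => //; apply: ler_wpM2l.
      by rewrite subr_ge0 ge_min lexx orbT.
    by rewrite ler_expR ler_wpM2r// ltW.
move=> /(ub_le_sup _) => /(_ (ex_intro _ B HB)).
by rewrite -/ls gerDl leNgt e0.
Qed.

End DelayInequality.

(** * The root omega, the critical speed and its asymptotics *)

Section CriticalSpeed.
Variable R : realType.
Implicit Types (m D kappa bk dk r c w omega : R).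

Definition is_omega bk dk : set R :=
  [set w | w < 0 /\ 2 * dk = bk * expR (- w) * (2 + w)].

Lemma is_omega_lt bk dk w : bk < 0 -> 0 < dk -> is_omega bk dk w -> w < -2.
Proof.
move=> bk0 dk0 [w0 E]; rewrite ltNge; apply/negP => w2.
have : bk * expR (- w) * (2 + w) <= 0.
  apply: mulr_le0_ge0; last by lra.
  by apply: mulr_le0_ge0; [exact: ltW | exact: expR_ge0].
by rewrite -E; move: dk0; lra.
Qed.

(** Any root lies below -2, where e^(-w) and - (2 + w) are both positive and strictly decreasing. *)
Lemma is_omega_inj bk dk w1 w2 : bk < 0 -> 0 < dk ->
  is_omega bk dk w1 -> is_omega bk dk w2 -> w1 = w2.
Proof.
move=> bk0 dk0.
wlog w12 : w1 w2 / w1 < w2.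
  move=> H h1 h2; case: (ltgtP w1 w2) => // h12; first exact: H.
  by apply/esym; exact: H.
move=> h1 h2; have := is_omega_lt bk0 dk0 h2 => w2lt.
case: h1 h2 => [_ E1] [_]; rewrite E1 => E.
have : expR (- w2) * (- (2 + w2)) < expR (- w1) * (- (2 + w1)).
  by apply: ltr_pM; rewrite ?expR_ge0 ?ltr_expR ?ltrN2 ?ltrD2l// oppr_ge0; lra.
have -> : expR (- w2) * (- (2 + w2)) = expR (- w1) * (- (2 + w1)).
  by apply: (@mulfI _ (- bk)); [rewrite oppr_eq0 lt_eqF | lra].
by rewrite ltxx.
Qed.

Lemma is_omega_ex bk dk : bk < 0 -> 0 < dk -> exists w, is_omega bk dk w.
Proof.
move=> bk0 dk0; pose f w := bk * expR w * (2 - w).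
(* The function [f] is the right-hand side of the equation at -w. Here - bk (B - 2) = 2 dk, and the
   remaining factor e^B is at least 1. *)
pose B := 2 + 2 * dk / - bk.
have B2 : 2 <= B by rewrite lerDl divr_ge0// ?mulr_ge0// ?oppr_ge0 ltW.
have f2 : f 2 = 0 by rewrite /f subrr mulr0.
have fB : 2 * dk <= f B.
  rewrite /f /B.
  have -> : bk * expR (2 + 2 * dk / - bk) * (2 - (2 + 2 * dk / - bk)) =
    expR (2 + 2 * dk / - bk) * (2 * dk) by field; rewrite lt_eqF.
  rewrite ler_peMl ?mulr_ge0 ?(ltW dk0)//; apply: le_trans (expR_ge1Dx _).
  by rewrite lerDl; exact: le_trans B2.
have [||w /[!in_itv]/= /andP[w2 wB] fw] := @IVT _ f 2 B (2 * dk) B2.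
- apply: continuous_subspaceT => x; apply: cvgM.
    by apply: cvgM; [exact: cvg_cst | exact: continuous_expR].
  by apply: cvgB; [exact: cvg_cst | exact: cvg_id].
- by rewrite f2 ge_min le_max fB mulr_ge0 ?(ltW dk0)//= orbT.
by exists (- w); split; [lra | rewrite opprK -fw].
Qed.

Definition omega_of bk dk := xget 0 (is_omega bk dk).

Lemma omega_ofP bk dk : bk < 0 -> 0 < dk -> is_omega bk dk (omega_of bk dk).
Proof.
by move=> bk0 dk0; have [w hw] := is_omega_ex bk0 dk0; apply: xgetPex; exists w.
Qed.

(* Any upper bound for the exact threshold with the same asymptotics will do;
   this one comes from [x < e^x], which absorbs the linear term
   [c l = x / r], [x = l c r], of the characteristic equation. *)
Definition critical_speed m D kappa bk dk r : \bar R :=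
  if r * - bk <= 1 then +oo%E
  else (mu_kappa m D kappa bk (omega_of bk dk)
        / (r * Num.sqrt (1 - (r * - bk)^-1)))%:E.

Lemma mu_kappa_gt0 m D kappa bk omega : 0 < m -> 0 < D -> 0 < kappa ->
  bk < 0 -> omega < 0 -> 0 < mu_kappa m D kappa bk omega.
Proof.
move=> m0 D0 k0 bk0 om0; rewrite /mu_kappa mulr_gt0 ?expR_gt0// sqrtr_gt0.
rewrite -mulrA; apply: mulr_gt0; first by rewrite !mulr_gt0 ?powR_gt0.
by rewrite -mulrNN -invrN divr_gt0 ?oppr_gt0.
Qed.

Lemma sub_inv_gt0 (x : R) : 1 < x -> 0 < 1 - x^-1.
Proof. by move=> x1; rewrite subr_gt0 invf_lt1//; apply: lt_trans x1. Qed.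

Lemma critical_speed_gt0 m D kappa bk dk r : 0 < m -> 0 < D -> 0 < kappa ->
  bk < 0 -> 0 < dk -> 0 < r -> (0 < critical_speed m D kappa bk dk r)%E.
Proof.
move=> m0 D0 k0 bk0 dk0 r0; rewrite /critical_speed; case: ifPn => [_|].
  exact: ltry.
rewrite -ltNge => rb; rewrite lte_fin divr_gt0//.
  by apply: mu_kappa_gt0 => //; case: (omega_ofP bk0 dk0).
by rewrite mulr_gt0// sqrtr_gt0 sub_inv_gt0.
Qed.

(* Tangency: [x |-> 1 + x + x^2/(2W)] touches [e^x] at 0 and stays below it. *)
Lemma expR_tangent_parabola (W x : R) : 2 <= W -> - W <= x ->
  1 + x + x ^+ 2 / (2 * W) <= expR x.
Proof.
move=> W2 Wx; have W0 : 0 < W by lra.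
(* For x >= -2 the parabola lies below (1 + x/2)^2 <= e^x, because W >= 2. For -W <= x < -2 it is at
   most 1 + x/2 < 0. *)
case: (leP (-2) x) => x2.
  have h1 : 1 + x / 2 <= expR (x / 2) by exact: expR_ge1Dx.
  have h0 : 0 <= 1 + x / 2 by lra.
  have := ler_pM h0 h0 h1 h1; rewrite -expRD -splitr; apply: le_trans.
  have : x ^+ 2 / (2 * W) <= x ^+ 2 / 4.
    by apply: ler_wpM2l; rewrite ?sqr_ge0// lef_pV2 ?posrE; lra.
  by lra.
apply: le_trans (expR_ge0 _).
have : x ^+ 2 / (2 * W) <= - x / 2.
  rewrite ler_pdivrMr; last lra.
  have : (- x) * (- x) <= (- x) * W by apply: ler_wpM2l; lra.
  by lra.
by lra.
Qed.

(** Put W = -omega. The equation for omega gives dk = - bk e^W (W - 2) / 2, and the left-hand side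
    equals - bk e^W w^2 / (2 W). After division by - bk e^W the claim is [expR_tangent_parabola] at
    x = w - W. *)
Lemma mu_kappa_bound m D kappa bk dk w : 0 < m -> 0 < D -> 0 < kappa ->
  bk < 0 -> 0 < dk -> 0 <= w ->
  D * m * kappa `^ (m - 1) * w ^+ 2
    / mu_kappa m D kappa bk (omega_of bk dk) ^+ 2 <= dk - bk * expR w.
Proof.
move=> m0 D0 k0 bk0 dk0 w0; have om := omega_ofP bk0 dk0.
have om2 := is_omega_lt bk0 dk0 om; move: om om2.
set omega := omega_of _ _ => -[om0 E] om2.
set A := D * m * kappa `^ (m - 1).
have A0 : 0 < A by rewrite /A !mulr_gt0 ?powR_gt0.
rewrite /mu_kappa exprMn sqr_sqrtr; last first.
  rewrite -mulrA; apply/ltW/mulr_gt0; first by rewrite !mulr_gt0 ?powR_gt0.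
  by rewrite -mulrNN -invrN divr_gt0 ?oppr_gt0.
have -> : expR (omega / 2) ^+ 2 = expR omega by rewrite expr2 -expRD -splitr.
have -> : 2 * D * m * kappa `^ (m - 1) * omega / bk = 2 * A * omega / bk.
  by rewrite /A !mulrA.
have [W WE] : exists W, W = - omega by exists (- omega).
have omE : omega = - W by rewrite WE opprK.
rewrite omE in E om2 om0 *; move: E; rewrite opprK => E.
have W2 : 2 < W by lra.
have Wn : W != 0 by rewrite gt_eqF//; lra.
have bkn : bk != 0 by rewrite lt_eqF.
have An : A != 0 by rewrite gt_eqF.
have eWn : expR W != 0 by rewrite gt_eqF ?expR_gt0.
have -> : A * w ^+ 2 / (2 * A * - W / bk * expR (- W)) =
  - bk * expR W * (w ^+ 2 / (2 * W)).
  by rewrite expRN; field; rewrite ?bkn ?Wn ?An ?eWn.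
have -> : dk - bk * expR w = - bk * expR W * ((W - 2) / 2 + expR (w - W)).
  rewrite expRB mulrDr.
  have -> : - bk * expR W * ((W - 2) / 2) = dk by lra.
  by congr (_ + _); field.
apply: ler_wpM2l; first by rewrite mulr_ge0 ?expR_ge0 ?oppr_ge0// ltW.
have wW : - W <= w - W by lra.
have := expR_tangent_parabola (ltW W2) wW.
have -> : (w - W) ^+ 2 / (2 * W) = w ^+ 2 / (2 * W) - w + W / 2 by field.
by lra.
Qed.

(** The right-hand side is split with weights s = 1 - 1 / (r (- bk)) and 1 - s. The first share
    covers the quadratic term, since c above the critical speed means mu^2 <= s (c r)^2; the second
    covers c l = w / r with w = l c r, since w < e^w. If r (- bk) <= 1, no positive share [s] is
    left and the critical speed is +oo. *)
Lemma critical_speed_characteristic m D kappa bk dk r c l :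
  0 < m -> 0 < D -> 0 < kappa -> bk < 0 -> 0 < dk -> 0 < r -> 0 <= l ->
  (critical_speed m D kappa bk dk r < c%:E)%E ->
  D * m * kappa `^ (m - 1) * l ^+ 2 + c * l < dk - bk * expR (l * (c * r)).
Proof.
move=> m0 D0 k0 bk0 dk0 r0 l0; rewrite /critical_speed; case: ifPn => //.
rewrite -ltNge => rb; rewrite lte_fin.
set mu := mu_kappa _ _ _ _ _; set s := 1 - _ => cC.
have s0 : 0 < s by exact: sub_inv_gt0.
have mu0 : 0 < mu by apply: mu_kappa_gt0 => //; case: (omega_ofP bk0 dk0).
have c0 : 0 < c.
  apply: le_lt_trans cC; apply: divr_ge0; first exact: ltW.
  by rewrite mulr_ge0 ?sqrtr_ge0 ?(ltW r0).
set w := l * (c * r).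
have w0 : 0 <= w by rewrite /w mulr_ge0// mulr_ge0 ?(ltW c0) ?(ltW r0).
have := mu_kappa_bound m0 D0 k0 bk0 dk0 w0; rewrite -/mu.
set A := D * m * kappa `^ (m - 1) => Hmu.
have A0 : 0 < A by rewrite /A !mulr_gt0 ?powR_gt0.
have cr : mu ^+ 2 <= s * (c * r) ^+ 2.
  move: cC; rewrite ltr_pdivrMr ?mulr_gt0 ?sqrtr_gt0// mulrA => cC.
  have := ler_pM (ltW mu0) (ltW mu0) (ltW cC) (ltW cC); rewrite -!expr2.
  by rewrite [X in _ <= X -> _]exprMn sqr_sqrtr ?(ltW s0)// [_ * s]mulrC.
have H1 : A * l ^+ 2 <= s * (dk - bk * expR w).
  apply: le_trans (ler_wpM2l (ltW s0) Hmu).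
  rewrite [s * (_ / _)]mulrA ler_pdivlMr ?exprn_gt0//.
  have -> : s * (A * w ^+ 2) = A * l ^+ 2 * (s * (c * r) ^+ 2) by rewrite /w; ring.
  by apply: ler_wpM2l => //; rewrite mulr_ge0 ?sqr_ge0// ltW.
have H2 : c * l < (r * - bk)^-1 * (dk - bk * expR w).
  have -> : c * l = (r * - bk)^-1 * (- bk * w) by rewrite /w; field; rewrite (gt_eqF r0) (lt_eqF bk0).
  rewrite ltr_pM2l ?invr_gt0; last by rewrite mulr_gt0 ?oppr_gt0.
  have := expR_ge1Dx w.
  have nb : 0 < - bk by rewrite oppr_gt0.
  move=> /(ler_wpM2l (ltW nb)); lra.
move: H1 H2; rewrite /s; lra.
Qed.

(** Once r (- bk) > 1, the product is [mu] divided by sqrt(1 - 1 / (r (- bk))), and this root tends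
    to 1. *)
Lemma critical_speed_cvg m D kappa bk dk : bk < 0 ->
  r * fine (critical_speed m D kappa bk dk r) @[r --> +oo] -->
    mu_kappa m D kappa bk (omega_of bk dk).
Proof.
move=> bk0; set mu := mu_kappa _ _ _ _ _.
have nb : 0 < - bk by rewrite oppr_gt0.
have : mu / Num.sqrt (1 - (r * - bk)^-1) @[r --> +oo] --> mu / Num.sqrt (1 - 0).
  apply: cvgM; first exact: cvg_cst.
  apply: cvgV; first by rewrite subr0 sqrtr1 oner_neq0.
  apply: (@cvg_comp _ _ _ (fun r => 1 - (r * - bk)^-1) Num.sqrt _ (nbhs (1 - 0 : R)));
    last exact: sqrt_continuous.
  apply: cvgB; first exact: cvg_cst.
  apply/cvgrPdist_lt => e e0; near=> r.
  rewrite sub0r normrN gtr0_norm ?invr_gt0.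
    rewrite -[e]invrK ltf_pV2 ?posrE ?invr_gt0//.
      rewrite -ltr_pdivrMr//; near: r; by apply: nbhs_pinfty_gt; exact: num_real.
    rewrite mulr_gt0//; near: r; by apply: nbhs_pinfty_gt; exact: num_real.
  rewrite mulr_gt0//; near: r; by apply: nbhs_pinfty_gt; exact: num_real.
rewrite subr0 sqrtr1 divr1; apply: cvg_trans; apply: near_eq_cvg; near=> r.
rewrite /critical_speed ifF/=.
  have r0 : 0 < r by near: r; by apply: nbhs_pinfty_gt; exact: num_real.
  by rewrite [(r * Num.sqrt _)^-1]invfM [r * (mu * _)]mulrCA mulVKf ?gt_eqF.
apply/negbTE; rewrite -ltNge -ltr_pdivrMr//; near: r; by apply: nbhs_pinfty_gt; exact: num_real.
Unshelve. all: by end_near. Qed.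

Lemma critical_speed_fin_num m D kappa bk dk : bk < 0 ->
  \forall r \near +oo, critical_speed m D kappa bk dk r \is a fin_num.
Proof.
move=> bk0; near=> r; rewrite /critical_speed ifF//.
apply/negbTE; rewrite -ltNge -ltr_pdivrMr ?oppr_gt0//.
near: r; by apply: nbhs_pinfty_gt; exact: num_real.
Unshelve. all: by end_near. Qed.

End CriticalSpeed.

(** * Limits, composition and linearisation tools for wave profiles *)

Section Wavefronts.
Variable R : realType.
Local Notation mu := (@lebesgue_measure R).

Lemma derive_linearization (f : R -> R) (a l : R) : is_derive a 1 f l ->
  forall e, 0 < e -> exists2 r, 0 < r &
    forall x, `|x - a| < r -> `|f x - f a - l * (x - a)| <= e * `|x - a|.
Proof.
move=> df e e0.
have H : (fun h : R => h^-1 *: ((f \o shift a) (h *: 1) - f a)) @ 0^' --> l.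
  by case: df => df <-; exact: df.
have : \forall h \near 0^', `|l - h^-1 *: ((f \o shift a) (h *: 1) - f a)| <= e.
  by move/cvgrPdist_le : H; apply.
rewrite near_withinE => /nbhs_ballP[r /= r0 Hr]; exists r => // x xr.
have [->|xa] := eqVneq x a; first by rewrite !subrr mulr0 subrr normr0 mulr0.
have h0 : x - a != 0 by rewrite subr_eq0.
have := Hr (x - a); rewrite /ball/= sub0r normrN => /(_ xr h0).
rewrite /GRing.scale/= mulr1 subrK distrC => H1.
have -> : f x - f a - l * (x - a) = ((x - a)^-1 * (f x - f a) - l) * (x - a).
  by rewrite mulrBl mulrAC mulVf// mul1r.
by rewrite normrM ler_wpM2r.
Qed.

Lemma nonincreasing_derive_le0 (f : R -> R) (T t l : R) : T <= t ->
  (forall s u, T <= s -> s <= u -> f u <= f s) -> is_derive t 1 f l -> l <= 0.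
Proof.
move=> Tt fmono df; rewrite leNgt; apply/negP => l0.
have l2 : 0 < l / 2 by rewrite divr_gt0.
have [r r0 Hr] := derive_linearization df l2.
have xt : t + r / 2 - t = r / 2 by ring.
have r2 : 0 < r / 2 by rewrite divr_gt0.
have := Hr (t + r / 2); rewrite xt gtr0_norm// => H.
have {}H := H (ltac:(lra) : r / 2 < r).
have tx : t <= t + r / 2 by lra.
have := fmono _ _ Tt tx; move: H; rewrite ler_norml => /andP[H _].
have := mulr_gt0 l2 r2; lra.
Qed.

(** The rates [b] and [d] are continuous only relative to [0, +oo); nonnegativity of [u] and [L]
    lets limits pass through them, also at 0. *)
Lemma cvg_within_nonneg_comp (F : set_system R) (f u : R -> R) (L : R) : Filter F ->
  {within [set x : R | 0 <= x], continuous f} -> (forall t, 0 <= u t) -> 0 <= L ->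
  u @ F --> L -> f (u t) @[t --> F] --> f L.
Proof.
move=> FF /subspace_continuousP cf u0 L0 uL.
apply: (@cvg_comp _ _ _ u f F (within [set x : R | 0 <= x] (nbhs L)));
  last by apply: cf.
move=> B /= HB; have := uL _ HB => /=; rewrite !nbhs_simpl /=.
by apply: filterS => s; apply; exact: u0.
Qed.

Lemma continuous_within_nonneg_comp (f u : R -> R) :
  {within [set x : R | 0 <= x], continuous f} -> continuous u ->
  (forall t, 0 <= u t) -> continuous (fun t => f (u t)).
Proof.
by move=> cf cu u0 t; apply: cvg_within_nonneg_comp (cu t) => //; exact: u0.
Qed.

(** Where u > 0 the power is differentiable; at a zero of [u], u < e^(1/m) gives u^m < e. *)
Lemma continuous_powR_nonneg (u : R -> R) (m : R) : 0 < m -> continuous u ->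
  (forall t, 0 <= u t) -> continuous (fun t => u t `^ m).
Proof.
move=> m0 cu u0 t; have := u0 t; rewrite le_eqVlt => /orP[/eqP ut0|ut0]; last first.
  apply: (@continuous_comp _ _ _ u (fun x => x `^ m)); first exact: cu.
  exact: is_derive_continuous (is_derive1_powR m ut0).
apply/cvgrPdist_lt => e e0; rewrite -ut0 powR0 ?gt_eqF//.
have e'0 : 0 < e `^ m^-1 by exact: powR_gt0.
have : \forall s \near t, `|u t - u s| < e `^ m^-1 by exact: (cvgrPdist_lt _ _).1 (cu t) _ e'0.
apply: filterS => s; rewrite -ut0 !sub0r !normrN !ger0_norm ?powR_ge0// => us.
have -> : e = (e `^ m^-1) `^ m by rewrite -powRrM mulVf ?gt_eqF// powRr1// ltW.
by apply: gt0_ltr_powR; rewrite ?nnegrE ?powR_ge0.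
Qed.

Lemma nondecreasing_bounded_limit (u : R -> R) (T M : R) :
  (forall s t, T <= s -> s <= t -> u s <= u t) -> (forall t, u t <= M) ->
  exists L, (forall t, T <= t -> u t <= L) /\
    forall e, 0 < e -> exists2 T', T <= T' & forall t, T' <= t -> L - e < u t.
Proof.
move=> umono uM; pose S := [set u t | t in [set t | T <= t]].
have hS : has_sup S.
  split; first by exists (u T); exists T => //=; exact: lexx.
  by exists M => _ [t _ <-].
exists (sup S); split.
  by move=> t Tt; apply: ub_le_sup; [case: hS | exists t].
move=> e e0; have [_ [T' TT' <-] HT'] := sup_adherent e0 hS.
by exists T' => // t T't; apply: lt_le_trans HT' _; exact: umono.
Qed.

(* If [g] stayed above [eta > 0], then [G], hence [w'], would tend to infinity. *)
Lemma no_drift (w f G g : R -> R) (A D c M eta T : R) : 0 < D ->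
  (forall t, A < t -> is_derive t 1 w ((c * f t + G t) / D) /\ is_derive t 1 G (g t)) ->
  (forall t, `|c * f t| <= M) -> (forall t, `|w t| <= M) -> 0 < eta ->
  ~ (forall t, T <= t -> eta <= g t).
Proof.
move=> D0 dw fM wM eta0 gT.
have [T1 [AT1 TT1]] : exists T1, A < T1 /\ T <= T1.
  exists (Num.max A T + 1); rewrite ltr_pwDr// ?le_max ?lexx//; split => //.
  by rewrite ler_wpDr// le_max lexx orbT.
have G_ge t : T1 <= t -> eta * (t - T1) <= G t - G T1.
  move=> T1t; apply: (@derive_ge_sub _ G g) => // x /andP[T1x _].
    exact: (dw x (lt_le_trans AT1 T1x)).2.
  by apply: gT; exact: le_trans T1x.
have M0 : 0 <= M by exact: le_trans (wM 0).
(* Chosen so that w' >= 2 M + 1 after [T2]; over one unit of time [w] would then grow by more than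
   the 2 M that |w| <= M permits. *)
pose T2 := T1 + (D * (2 * M + 1) + M + `|G T1|) / eta.
have T12 : T1 <= T2.
  rewrite lerDl divr_ge0 ?(ltW eta0)// !addr_ge0// mulr_ge0 ?(ltW D0)//; lra.
have : (2 * M + 1) * (T2 + 1 - T2) <= w (T2 + 1) - w T2.
  apply: (@derive_ge_sub _ w (fun t => (c * f t + G t) / D)); first by rewrite lerDl.
    by move=> x /andP[T2x _]; exact: (dw x (lt_le_trans AT1 (le_trans T12 T2x))).1.
  move=> x /andP[T2x _]; rewrite ler_pdivlMr//.
  have := G_ge x (le_trans T12 T2x).
  have : eta * (T2 - T1) <= eta * (x - T1).
    by apply: ler_wpM2l; [exact: ltW | rewrite lerD2r].
  have -> : eta * (T2 - T1) = D * (2 * M + 1) + M + `|G T1|.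
    by rewrite /T2; field; rewrite gt_eqF.
  have := fM x; rewrite ler_norml => /andP[+ _].
  have := ler_norm (- G T1); rewrite normrN; lra.
have -> : T2 + 1 - T2 = 1 by ring.
have := wM T2; have := wM (T2 + 1); rewrite !ler_norml => /andP[_ +] /andP[+ _].
lra.
Qed.

(** The sign [sg] allows profiles approaching kappa from below and from above to share one
    argument. *)
Lemma signed_linearization (sg x y l e : R) : sg = 1 \/ sg = -1 -> 0 <= sg * x ->
  `|y - l * x| <= e * `|x| -> (l - e) * (sg * x) <= sg * y.
Proof.
move=> sgE sx; have nx : `|x| = sg * x.
  by case: sgE sx => ->; rewrite ?mul1r ?mulN1r => sx;
    [rewrite ger0_norm | rewrite ler0_norm// -oppr_ge0].
rewrite nx ler_norml => /andP[H1 H2].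
by move: sgE H1 H2 => [] -> H1 H2; lra.
Qed.

(** * Monotone semi-wavefronts: regularity, limit and characteristic inequality *)

Section Profile.
Variables (m D r c kappa : R) (b b1 d d1 d2 phi : R -> R).
Hypotheses (m1 : 1 < m) (D0 : 0 < D) (r0 : 0 < r).
Hypothesis std : standing b b1 d d1 d2 kappa.
Hypothesis bk0 : b1 kappa < 0.
Hypothesis sw : semi_wavefront m D r c b d kappa phi.

Let h := c * r.
Let w t := phi t `^ m.
Let g t := d (phi t) - b (phi (t - h)).

Let m0 : 0 < m. Proof. by apply: lt_trans m1. Qed.
Let c0 : 0 < c. Proof. by case: sw. Qed.
Let h0 : 0 < h. Proof. by rewrite mulr_gt0. Qed.
Let kappa0 : 0 < kappa. Proof. by case: std => _ [_ _ _ _ []]. Qed.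
Let bdk : b kappa = d kappa. Proof. by case: std => _ [_ _ _ _ []]. Qed.
Let phi0 t : 0 <= phi t. Proof. by case: sw. Qed.
Let cphi : continuous phi. Proof. by case: sw. Qed.
Let db : is_derive kappa 1 b (b1 kappa).
Proof. by case: std => _ [[_ [_ H]] _ _ _ _]; exact: H. Qed.
Let dd : is_derive kappa 1 d (d1 kappa).
Proof. by case: std => [[[_ [_ H]] _ _ _ _] _]; exact: H. Qed.

Let cdphi : continuous (fun t => d (phi t)).
Proof.
by case: std => [[[H _] _ _ _ _] _]; exact: continuous_within_nonneg_comp.
Qed.

Let cshift : continuous (fun t : R => t - h).
Proof. by move=> t; apply: cvgB; [exact: cvg_id | exact: cvg_cst]. Qed.

Let cbphi : continuous (fun t => b (phi (t - h))).
Proof.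
have cb : continuous (fun t => b (phi t)).
  by case: std => _ [[H _] _ _ _ _]; exact: continuous_within_nonneg_comp.
move=> t; apply: (@continuous_comp _ _ _ (fun t => t - h) (fun t => b (phi t))).
  exact: cshift.
exact: cb.
Qed.

Let cw : continuous w.
Proof. exact: continuous_powR_nonneg. Qed.

Lemma profile_weak_eq chi : test_fun chi ->
  - c * Rintegral mu setT (fun t => phi t * derive1 chi t)
  = D * Rintegral mu setT (fun t => w t * derive1n 2 chi t)
    - Rintegral mu setT (fun t => g t * chi t).
Proof.
move=> tchi; case: sw => _ _ _ [_ _ _ /(_ _ tchi) ->] _.
suff -> : Rintegral mu setT (fun t => g t * chi t) =
    Rintegral mu setT (fun t => d (phi t) * chi t) -
    Rintegral mu setT (fun t => b (phi (t - c * r)) * chi t).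
  by rewrite opprB addrA addrAC.
case: tchi => schi [M HM].
have cchi : continuous chi.
  by move=> x; apply/differentiable_continuous/derivable1_diffP; exact: (schi 0%N x).
have S x : x < - M \/ M < x -> chi x = 0.
  move=> H; apply: HM; rewrite ltNge ler_norml; apply/negP => /andP[H1 H2].
  by case: H; rewrite ltNge ?H1 ?H2.
rewrite !(@Rintegral_support _ _ (- M) M);
  [|by move=> x /S H; rewrite H mulr0..].
rewrite -continuous_RintegralB; [|exact: continuous_mulR..].
by apply: eq_Rintegral => x _; rewrite mulrBl.
Qed.

Lemma profile_regular (A : R) : exists G : R -> R, forall t : R, A < t ->
  is_derive t 1 w ((c * phi t + G t) / D) /\ is_derive t 1 G (g t).
Proof.
apply: weak_solution_regular => //; last exact: profile_weak_eq.
by apply: continuous_subR.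
Qed.

(* Any further equality would force an interior minimum of [b] beyond [s_M]. *)
Lemma positive_equilibrium_unique L : 0 < L -> d L = b L -> L = kappa.
Proof.
case: std => [[[cd [_ dd1]] _ _ d1pos _] [[cb _] _ [sM [sM0 sMk bmax bext]] _ [_ _ _ _ dltb]]].
move=> L0 dL; have [Lk|kL|//] := ltgtP L kappa.
  by have [] := dltb L; rewrite ?L0 ?Lk// dL ltxx.
have dkL : d kappa < d L.
  have kn : kappa <= L by exact: ltW.
  have [||x /[!in_itv]/= /andP[kx xL] E] := @MVT_segment _ d d1 kappa L kn.
  - move=> x /[!in_itv]/= /andP[kx _]; apply: dd1; exact: lt_trans kx.
  - apply: (@is_derive_within_continuous _ d d1) => x /andP[kx _].
    by apply: dd1; exact: lt_le_trans kx.
  by rewrite -subr_gt0 E mulr_gt0 ?subr_gt0// d1pos//; exact: lt_le_trans kx.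
have sML : sM <= L by exact/ltW/(lt_trans sMk).
have cbs : {within `[sM, L], continuous b}.
  apply: continuous_subspaceW cb => x /=; rewrite in_itv/= => /andP[sMx _].
  by apply: le_trans sMx; exact: ltW.
(* The minimum is at most b kappa < b L <= b sM, so neither endpoint attains it. *)
have [x /[!in_itv]/= /andP[sMx xL] Hx] := EVT_min sML cbs.
have bxk : b x <= b kappa by apply: Hx; rewrite in_itv/= !ltW.
have bkL : b kappa < b L by rewrite bdk -dL.
have sMx' : sM < x.
  rewrite lt_neqAle sMx andbT; apply/eqP => E.
  have := bmax L (ltW L0); rewrite E => H.
  by have := le_lt_trans (le_trans H bxk) bkL; rewrite ltxx.
have xL' : x < L.
  rewrite lt_neqAle xL andbT; apply/eqP => E.
  by have := le_lt_trans bxk bkL; rewrite E ltxx.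
have xs : x = sM.
  apply: bext; first exact: lt_trans sMx'.
  right; near=> y; apply: Hx; rewrite in_itv/=; apply/andP; split.
    by near: y; exact: lt_le_nbhsr.
  by near: y; exact: lt_le_nbhsl.
by move: sMx'; rewrite xs ltxx.
Unshelve. all: by end_near. Qed.

Let phi_bounded : exists M, forall t, phi t <= M.
Proof.
case: sw => _ _ _ [_ _ [M HM] _] _; exists M => t.
by apply: le_trans (HM t); exact: ler_norm.
Qed.

(** The source term [g] tends to d L - b L, and [no_drift] excludes a nonzero limit; for a negative
    one it is applied to the negated functions. *)
Lemma profile_limit_equilibrium L :
  (phi t @[t --> +oo] --> L) -> 0 <= L -> d L = b L.
Proof.
move=> phiL L0.
have gL : g t @[t --> +oo] --> d L - b L.
  apply: cvgB.
    by apply: cvg_within_nonneg_comp => //; case: std => [[[]]].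
  have cb : b (phi t) @[t --> +oo] --> b L.
    by apply: cvg_within_nonneg_comp => //; case: std => _ [[]].
  apply: (@cvg_comp _ _ _ (fun t => t - h) (fun t => b (phi t)) _ (pinfty_nbhs R)); last exact: cb.
  apply/cvgryPge => B; near=> t; rewrite lerBrDr; near: t.
  by apply: nbhs_pinfty_ge; exact: num_real.
have [M HM] := phi_bounded.
have M0 : 0 <= M by exact: le_trans (phi0 0) (HM 0).
have [G HG] := profile_regular 0.
pose M' := Num.max (c * M) (M `^ m).
have fM t : `|c * phi t| <= M'.
  rewrite ger0_norm ?mulr_ge0 ?(ltW c0)// le_max; apply/orP; left.
  by rewrite ler_pM2l.
have wM t : `|w t| <= M'.
  rewrite ger0_norm ?powR_ge0// le_max; apply/orP; right.
  by apply: ge0_ler_powR; rewrite ?nnegrE ?(ltW m0).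
apply/eqP; rewrite -subr_eq0; apply/eqP; apply: contrapT => gL0.
have [gneg|gpos] : (d L - b L < 0) \/ (0 < d L - b L).
  by have [? | ? | ] := ltgtP (d L - b L) 0; [left | right |].
- have eta0 : 0 < - (d L - b L) / 2 by rewrite divr_gt0// oppr_gt0.
  have : \forall t \near +oo, g t < (d L - b L) / 2.
    by apply: (cvgr_lt (d L - b L)) => //; lra.
  move=> [T [_ HT]].
  apply: (@no_drift (fun t => - w t) (fun t => - phi t) (fun t => - G t)
    (fun t => - g t) 0 D c M' (- (d L - b L) / 2) (T + 1)) => //.
  + move=> t t0; have [H1 H2] := HG t t0; split; last exact: is_deriveN.
    apply: is_derive_eq (is_deriveN H1) _.
    by rewrite -mulNr mulrN -opprD.
  + by move=> t; rewrite mulrN normrN.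
  + by move=> t; rewrite normrN.
  + by move=> t Tt; have := HT t (ltac:(lra) : T < t); rewrite /=; lra.
- have eta0 : 0 < (d L - b L) / 2 by rewrite divr_gt0.
  have : \forall t \near +oo, (d L - b L) / 2 < g t.
    by apply: (cvgr_gt (d L - b L)) => //; lra.
  move=> [T [_ HT]].
  apply: (@no_drift w phi G g 0 D c M' ((d L - b L) / 2) (T + 1)) => //.
  by move=> t Tt; apply/ltW/HT; lra.
Unshelve. all: by end_near. Qed.

(** As b'(kappa) is nonzero, an error of half that slope cannot cancel the linear term. *)
Lemma birth_rate_injective_near_kappa : exists2 e, 0 < e &
  forall x, `|x - kappa| < e -> b x = b kappa -> x = kappa.
Proof.
have e0 : 0 < - b1 kappa / 2 by rewrite divr_gt0// oppr_gt0.
have [e ep He] := derive_linearization db e0; exists e => // x xe bx.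
have := He x xe; rewrite bx subrr sub0r normrN normrM ltr0_norm// => H.
apply/eqP; rewrite -subr_eq0 -normr_le0; rewrite leNgt; apply/negP => xk.
by move: H; rewrite ler_pM2r//; lra.
Qed.

(* Constancy on [t, +oo) propagates to the left through the delay. *)
Lemma profile_not_eventually_kappa t1 : ~ (forall s, t1 <= s -> phi s = kappa).
Proof.
move=> Ht1; pose S := [set t | forall s, t <= s -> phi s = kappa].
have [T HT] : exists T, forall t, t <= T -> phi t < kappa.
  case: sw => _ _ _ _ [H _ _ _].
  have : \forall t \near -oo, phi t < kappa by exact: (cvgr_lt 0).
  move=> [T [_ HT]]; exists (T - 1) => t tT; apply: HT; apply: le_lt_trans tT _.
  by rewrite ltrBlDr ltrDl.
have hS : has_inf S.
  split; first by exists t1.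
  exists T => t St; rewrite leNgt; apply/negP => tT.
  by have := HT _ (lexx T); rewrite St ?ltxx// ltW.
pose ts := inf S.
have after t : ts < t -> phi t = kappa.
  move=> tst; have et : 0 < t - ts by rewrite subr_gt0.
  have [u Su] := inf_adherent et hS; rewrite addrC subrK => ut.
  by apply: Su; exact: ltW.
have cont_ts e : 0 < e ->
    exists2 u, 0 < u & forall t, `|ts - t| < u -> `|phi ts - phi t| < e.
  move=> e0; have /cvgrPdist_lt/(_ e e0)/nbhs_ballP[u /= u0 H] := @cphi ts.
  by exists u => // t tu; exact: H.
have at_ts : phi ts = kappa.
  apply: contrapT => /eqP ne.
  have e0 : 0 < `|phi ts - kappa| by rewrite normr_gt0 subr_eq0.
  have [u u0 /(_ (ts + u / 2))] := cont_ts _ e0.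
  rewrite (@after (ts + u / 2)); last by rewrite ltrDl divr_gt0.
  rewrite ltxx; have -> : ts - (ts + u / 2) = - (u / 2) by ring.
  rewrite normrN gtr0_norm ?divr_gt0// => H; suff : false by []; apply: H; lra.
have [e e0 He] := birth_rate_injective_near_kappa.
have [u u0 Hu] : exists2 u, 0 < u & forall t, `|ts - t| < u -> `|phi t - kappa| < e.
  have [u u0 H] := cont_ts _ e0; exists u => // t tu.
  by rewrite distrC -at_ts; exact: H.
have [G HG] := profile_regular ts.
have wc t : ts < t -> w t = kappa `^ m by move=> /after; rewrite /w => ->.
(* A constant [w] has zero derivative, which fixes [G]; a constant [G] in turn makes [g] vanish, as
   [gc] uses. *)
have Gc t : ts < t -> G t = - (c * kappa).
  move=> tst; have [H1 _] := HG t tst.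
  have near_w : \near t, w t = (fun=> kappa `^ m) t.
    near=> s; apply: wc; near: s; exact: lt_nbhsr.
  have H2 := near_eq_is_derive near_w H1.
  have : (c * phi t + G t) / D = 0.
    by case: H2 => _ <-; case: (is_derive_cstR (kappa `^ m) t) => _ <-.
  move=> /eqP; rewrite mulf_eq0 invr_eq0 (gt_eqF D0) orbF addrC addr_eq0 => /eqP ->.
  by rewrite after.
have gc t : ts < t -> b (phi (t - h)) = b kappa.
  move=> tst; have [_ H1] := HG t tst.
  have near_G : \near t, G t = (fun=> - (c * kappa)) t.
    near=> s; apply: Gc; near: s; exact: lt_nbhsr.
  have H2 := near_eq_is_derive near_G H1.
  have : g t = 0.
    by case: H2 => _ <-; case: (is_derive_cstR (- (c * kappa)) t) => _ <-.
  by rewrite /g after// -bdk => /eqP; rewrite subr_eq0 => /eqP <-.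
(* On [ts - k, ts], k < u keeps [phi] where [b] determines it, and k < h makes s + h > ts, so that
   [gc] applies at s + h. The infimum [ts] is thereby undercut. *)
pose k := Num.min (u / 2) (h / 2).
have k0 : 0 < k by rewrite lt_min !divr_gt0.
have [ku kh] : k <= u / 2 /\ k <= h / 2 by rewrite !ge_min !lexx orbT.
have : S (ts - k).
  move=> s tss; have [sts|] := ltP ts s; first exact: after.
  move=> sts; apply: He.
    by apply: Hu; rewrite ger0_norm; lra.
  have := gc (s + h); rewrite addrK; apply.
  by move: h0; lra.
move=> /(ge_inf hS.2); rewrite -/ts lerBrDl gerDr leNgt k0 => /negP; apply.
by [].
Unshelve. all: by end_near. Qed.

(** The limit is positive by the liminf condition, hence it is kappa. If it were attained,
    monotonicity would keep [phi] equal to kappa from then on. *)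
Lemma profile_monotone_limit (sg T : R) : sg = 1 \/ sg = -1 ->
  (forall s t, T <= s -> s <= t -> sg * phi s <= sg * phi t) ->
  phi t @[t --> +oo] --> kappa /\ forall t, T <= t -> sg * phi t < sg * kappa.
Proof.
move=> sgE mono; have sg2 : sg * sg = 1 by case: sgE => ->; ring.
have nsg : `|sg| = 1 by case: sgE => ->; rewrite ?normrN normr1.
have [M HM] : exists M, forall t, sg * phi t <= M.
  have [M HM] := phi_bounded; exists M => t; apply: le_trans (ler_norm _) _.
  by rewrite normrM nsg mul1r ger0_norm.
have [L' [HL1 HL2]] := nondecreasing_bounded_limit (u := fun t => sg * phi t) mono HM.
have [L Ldef] : exists L, L = sg * L' by exists (sg * L').
have sgL : sg * L = L' by rewrite Ldef mulrA sg2 mul1r.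
have phiL : phi t @[t --> +oo] --> L.
  apply/cvgrPdist_le => e e0; have [T' TT' HT'] := HL2 e e0.
  near=> t; have T't : T' <= t by near: t; apply: nbhs_pinfty_ge; exact: num_real.
  have -> : L - phi t = sg * (L' - sg * phi t) by rewrite Ldef mulrBr mulrA sg2 mul1r.
  rewrite normrM nsg mul1r ger0_norm ?subr_ge0; last exact/HL1/(le_trans TT').
  by have := HT' t T't; lra.
have L0 : 0 < L.
  case: sw => _ _ _ _ [_ [a [a0 Ha]] _ _]; apply: lt_le_trans a0 _.
  exact: (cvgr_to_ge phiL).
have LE := positive_equilibrium_unique L0 (profile_limit_equilibrium phiL (ltW L0)).
rewrite -LE; split => // t Tt; rewrite lt_neqAle sgL HL1// andbT.
apply/eqP => E; apply: (@profile_not_eventually_kappa t) => s ts.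
have : sg * phi s = sg * L.
  apply/eqP; rewrite eq_le sgL HL1 ?(le_trans Tt)//= -E; exact: mono.
by move=> /(congr1 ( *%R sg)); rewrite !mulrA sg2 !mul1r LE.
Unshelve. all: by end_near. Qed.

(** In the variable w = phi^m the second-order part is linear, and phi = [psi] (w) is smooth near K
    = kappa^m. Linearising at K puts v = sg (K - w) under [delay_inequality_characteristic]. *)
Lemma profile_monotone_root (sg T : R) : sg = 1 \/ sg = -1 ->
  (forall s t, T <= s -> s <= t -> sg * phi s <= sg * phi t) ->
  exists2 l, 0 <= l &
    d1 kappa - b1 kappa * expR (l * h) <= D * m * kappa `^ (m - 1) * l ^+ 2 + c * l.
Proof.
move=> sgE mono; have [phik below] := profile_monotone_limit sgE mono.
have dk0 : 0 < d1 kappa by case: std => [[_ _ _ H _] _]; exact: H.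
pose psi x := x `^ m^-1.
pose psi1 x := m^-1 * x `^ (m^-1 - 1).
have dpsi (x : R) : 0 < x -> is_derive x 1 psi (psi1 x).
  by move=> x0; exact: is_derive1_powR.
have phiE t : phi t = psi (w t).
  by rewrite /psi /w -powRrM mulfV ?gt_eqF// powRr1.
pose K := kappa `^ m.
have K0 : 0 < K by exact: powR_gt0.
have psiK : psi K = kappa by rewrite /psi /K -powRrM mulfV ?gt_eqF// powRr1// ltW.
have wK : w t @[t --> +oo] --> K.
  apply: (@cvg_comp _ _ _ phi (fun x => x `^ m) _ (nbhs kappa)) => //.
  exact: is_derive_continuous (is_derive1_powR m kappa0).
have [T0 TT0 w_gt0] : exists2 T0, T <= T0 & forall t, T0 <= t -> 0 < w t.
  have : \forall t \near +oo, 0 < w t by exact: (cvgr_gt K).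
  move=> [T1 [_ HT1]]; exists (Num.max T (T1 + 1)); first by rewrite le_max lexx.
  by move=> t; rewrite ge_max => /andP[_ Tt]; apply: HT1; lra.
have [G HG] := profile_regular (T0 - 1).
have HG' (t : R) : T0 <= t -> is_derive t 1 w ((c * phi t + G t) / D) /\ is_derive t 1 G (g t).
  by move=> T0t; apply: HG; lra.
pose w1 t := (c * phi t + G t) / D.
(* The unsimplified sums are those produced by [is_derive_addR] and [is_deriveN]. *)
pose v t := sg * (K + - w t).
pose v1 t := sg * (0 + - w1 t).
pose phi1 t := psi1 (w t) * w1 t.
pose v2 t := sg * (0 + - (D^-1 * (c * phi1 t + g t))).
have dv (t : R) : T0 <= t -> is_derive t 1 v (v1 t).
  move=> T0t; have [H _] := HG' t T0t.
  exact: is_derive_scaleR (is_derive_addR (is_derive_cstR K t) (is_deriveN H)).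
have dphi (t : R) : T0 <= t -> is_derive t 1 phi (phi1 t).
  move=> T0t; have [H _] := HG' t T0t.
  have -> : phi = (fun t => psi (w t)) by apply/funext => s; rewrite -phiE.
  exact: is_derive_compR (dpsi _ (w_gt0 _ T0t)) H.
have dv1 (t : R) : T0 <= t -> is_derive t 1 v1 (v2 t).
  move=> T0t; have [_ H] := HG' t T0t.
  have -> : v1 = (fun t => sg * (0 + - (D^-1 * (c * phi t + G t)))).
    by apply/funext => s; rewrite /v1 /w1 [_ / D]mulrC.
  exact: is_derive_scaleR (is_derive_addR (is_derive_cstR 0 t) (is_deriveN
    (is_derive_scaleR D^-1 (is_derive_addR (is_derive_scaleR c (dphi t T0t)) H)))).
have v_gt0 (t : R) : T0 <= t -> 0 < v t.
  move=> T0t; have := below t (le_trans TT0 T0t); rewrite /v /K /w.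
  case: sgE => ->; rewrite ?mul1r ?mulN1r ?ltrN2 ?oppr_gt0 ?subr_gt0 ?subr_lt0 => H;
    apply: gt0_ltr_powR => //; rewrite nnegrE//; exact: ltW.
have v_mono (s t : R) : T0 <= s -> s <= t -> v t <= v s.
  move=> T0s st; have := mono s t (le_trans TT0 T0s) st; rewrite /v /w.
  case: sgE => ->; rewrite ?mul1r ?mulN1r ?lerN2 ?lerD2l ?lerN2 => H;
    by apply: ge0_ler_powR; rewrite ?nnegrE// ltW.
have v1_le0 (t : R) : T0 <= t -> v1 t <= 0.
  by move=> T0t; exact: nonincreasing_derive_le0 T0t v_mono (dv t T0t).
(* The factor 1 / (m kappa^(m-1)) of the change of variable multiplies every coefficient except D;
   dividing by it at the end turns D into D m kappa^(m-1). *)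
pose s := psi1 K.
have s0 : 0 < s by rewrite mulr_gt0 ?invr_gt0 ?powR_gt0.
have sE : s = (m * kappa `^ (m - 1))^-1.
  rewrite /s /psi1 /K -powRrM mulrBr mulfV ?gt_eqF// mulr1 -opprB powRN.
  by rewrite invfM.
have q00 : 0 < d1 kappa * s by rewrite mulr_gt0.
have p00 : 0 < - b1 kappa * s by rewrite mulr_gt0// oppr_gt0.
have c00 : 0 <= c * s by rewrite mulr_ge0 ?ltW.
have ddpsi : is_derive K 1 (fun x => d (psi x)) (d1 kappa * s).
  by apply: is_derive_compR (dpsi _ K0); rewrite psiK.
have dbpsi : is_derive K 1 (fun x => b (psi x)) (b1 kappa * s).
  by apply: is_derive_compR (dpsi _ K0); rewrite psiK.
have cpsi1 : {for K, continuous psi1}.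
  apply: cvgM; first exact: cvg_cst.
  exact: is_derive_continuous (is_derive1_powR _ K0).
have delay (e : R) : 0 < e -> exists T', forall t, T' <= t ->
    (c * s + e) * v1 t + (d1 kappa * s - e) * v t + (- b1 kappa * s - e) * v (t - h)
    <= D * v2 t.
  move=> e0; have [r1 r10 Hr1] := derive_linearization ddpsi e0.
  have [r2 r20 Hr2] := derive_linearization dbpsi e0.
  have [r3 r30 Hr3] : exists2 r3, 0 < r3 & forall x, `|x - K| < r3 -> c * psi1 x <= c * s + e.
    have ec : 0 < e / c by rewrite divr_gt0.
    have /cvgrPdist_lt/(_ _ ec)/nbhs_ballP[r3 /= r30 H] := cpsi1.
    exists r3 => // x xr; rewrite addrC -lerBlDr -mulrBr mulrC -ler_pdivlMr//.
    apply: ltW; apply: le_lt_trans (ler_norm _) _; rewrite distrC; apply: H.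
    by rewrite /ball/= distrC.
  have [rr [rr0 rr1 rr2 rr3]] : exists rr, [/\ 0 < rr, rr <= r1, rr <= r2 & rr <= r3].
    exists (Num.min r1 (Num.min r2 r3)).
    by rewrite !lt_min r10 r20 r30 !ge_min !lexx !orbT.
  have [T1 HT1] : exists T1, forall t, T1 <= t -> `|w t - K| < rr.
    have /cvgrPdist_lt/(_ _ rr0) [T1 [_ H]] := wK.
    by exists (T1 + 1) => t Tt; rewrite distrC; apply: H; lra.
  exists (Num.max T0 T1 + h) => t Tt.
  have [T0t T0th T1t T1th] : [/\ T0 <= t, T0 <= t - h, T1 <= t & T1 <= t - h].
    have H1 : T0 <= Num.max T0 T1 by rewrite le_max lexx.
    have H2 : T1 <= Num.max T0 T1 by rewrite le_max lexx orbT.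
    by move: h0 => h0'; split; lra.
  (* As v1 <= 0, an upper bound on c psi1(w) is what bounds the product from below. *)
  have F1 : (c * s + e) * v1 t <= c * psi1 (w t) * v1 t.
    apply: ler_wnM2r; first exact: v1_le0.
    by apply: Hr3; exact: lt_le_trans (HT1 _ T1t) rr3.
  have F2 : (d1 kappa * s - e) * v t <= sg * (d kappa - d (phi t)).
    apply: signed_linearization => //; first exact/ltW/v_gt0.
    have := Hr1 _ (lt_le_trans (HT1 _ T1t) rr1); rewrite -phiE psiK.
    rewrite [in X in _ <= X -> _]distrC; congr (_ <= _); rewrite -normrN.
    by congr (`|_|); ring.
  have F3 : (- b1 kappa * s - e) * v (t - h) <= sg * (b (phi (t - h)) - b kappa).
    apply: signed_linearization => //; first exact/ltW/v_gt0.
    have := Hr2 _ (lt_le_trans (HT1 _ T1th) rr2); rewrite -phiE psiK.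
    rewrite [in X in _ <= X -> _]distrC; congr (_ <= _).
    by congr (`|_|); ring.
  (* The exact equation for [v]; b kappa = d kappa allows both rates to be centred at kappa. *)
  have -> : D * v2 t = c * psi1 (w t) * v1 t + sg * (d kappa - d (phi t))
      + sg * (b (phi (t - h)) - b kappa).
    by rewrite /v2 /phi1 /v1 /g bdk; field; rewrite gt_eqF.
  by apply: lerD => //; exact: lerD.
have [l l0 Hl] := delay_inequality_characteristic D0 h0 c00 q00 p00 dv dv1 v_gt0 v1_le0 delay.
exists l => //; rewrite -(ler_pM2r s0).
have -> : (d1 kappa - b1 kappa * expR (l * h)) * s =
  d1 kappa * s + - b1 kappa * s * expR (l * h) by ring.
apply: le_trans Hl _; rewrite mulrDl lerD//; last by rewrite mulrAC.
rewrite sE; have mk : m * kappa `^ (m - 1) != 0 by rewrite gt_eqF// mulr_gt0 ?powR_gt0.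
have -> : D * m * kappa `^ (m - 1) * l ^+ 2 = D * l ^+ 2 * (m * kappa `^ (m - 1)) by ring.
by rewrite mulfK.
Qed.

End Profile.
End Wavefronts.

(* C m D kappa b'(kappa) d'(kappa) r  is  c_kappa *)
Theorem theorem2p5 (R : realType) :
  exists C : R -> R -> R -> R -> R -> R -> \bar R,
  forall (m D kappa : R) (b b1 d d1 d2 : R -> R),
    1 < m -> 0 < D -> standing b b1 d d1 d2 kappa -> b1 kappa < 0 ->
    (forall r : R, 0 < r ->
       (0 < C m D kappa (b1 kappa) (d1 kappa) r)%E /\
       forall (c : R) (phi : R -> R),
         (C m D kappa (b1 kappa) (d1 kappa) r < c%:E)%E ->
         semi_wavefront m D r c b d kappa phi ->
         ~ eventually_monotone phi) /\
    exists omega : R,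
      [/\ omega < -2,
          2 * d1 kappa = b1 kappa * expR (- omega) * (2 + omega),
          (forall w : R, w < 0 ->
             2 * d1 kappa = b1 kappa * expR (- w) * (2 + w) -> w = omega),
          (\forall r \near +oo,
             C m D kappa (b1 kappa) (d1 kappa) r \is a fin_num) &
          (r * fine (C m D kappa (b1 kappa) (d1 kappa) r)) @[r --> +oo]
            --> mu_kappa m D kappa (b1 kappa) omega].
Proof.
exists (@critical_speed R) => m D kappa b b1 d d1 d2 m1 D0 std bk0.
have m0 : 0 < m by exact: lt_trans m1.
have k0 : 0 < kappa by case: std => _ [_ _ _ _ []].
have dk0 : 0 < d1 kappa by case: std => [[_ _ _ H _] _]; exact: H.
split=> [r r0|].
  split=> [|c phi cC sw [T mono]]; first exact: critical_speed_gt0.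
  have [sg [sgE sgmono]] : exists sg : R, (sg = 1 \/ sg = -1) /\
      forall s t, T <= s -> s <= t -> sg * phi s <= sg * phi t.
    case: mono => H; [exists 1 | exists (-1)].
      by split; [left | move=> s t Ts st; rewrite !mul1r; exact: H].
    by split; [right | move=> s t Ts st; rewrite !mulN1r lerN2; exact: H].
  (* Monotonicity yields an l >= 0 satisfying the characteristic inequality, whose strict converse
     holds at every l >= 0 above the critical speed. *)
  have [l l0] := profile_monotone_root m1 D0 r0 std bk0 sw sgE sgmono.
  by rewrite leNgt (critical_speed_characteristic m0 D0 k0 bk0 dk0 r0 l0 cC).
have om := omega_ofP bk0 dk0.
exists (omega_of (b1 kappa) (d1 kappa)); split.
- exact: is_omega_lt om.
- by case: om.
- by move=> w w0 E; apply: (is_omega_inj bk0 dk0) om; split.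
- exact: critical_speed_fin_num.
- exact: critical_speed_cvg.
Qed.
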